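(* Let $N\ge 1$ be odd and let $q\in\mathbb C$ be a primitive $N$-th root of unity. Let $S$ be the (oriented) once-punctured torus and let $\varphi:S\to S$ be a pseudo-Anosov (orientation-preserving) diffeomorphism. Set $R=\begin{pmatrix}1&0\\1&1\end{pmatrix}$ and $L=\begin{pmatrix}1&1\\0&1\end{pmatrix}$, and choose an orientation-preserving identification $S\cong(\mathbb R^2-\mathbb Z^2)/\mathbb Z^2$ (hence $H_1(S)\cong\mathbb Z^2$) for which the action of $\varphi$ on $H_1(S)$ is given by a matrix $A_\varphi=\pm A_1A_2\cdots A_n$ with each $A_i\in\{R,L\}$. For $0\le i\le n$ let $\lambda_{(0)}$ be the ideal triangulation of $S$ with edges of slopes $0,\infty,1$ and let $\lambda_{(i)}=A_1\cdots A_i(\lambda_{(0)})$, so that $\lambda_{(n)}=\varphi(\lambda_{(0)})$. The edges of $\lambda_{(i)}$ all have slope in $[0,\infty]$; denote by $\lambda_{(i)1}$ the one of lowest slope, by $\lambda_{(i)2}$ the one of highest slope, and by $\lambda_{(i)3}$ the remaining one. Let $x_{(i)1},x_{(i)2}$ be the exponential shear-bend parameters along $\lambda_{(i)1},\lambda_{(i)2}$ of the pleated surface with pleating locus $\lambda_{(i)}$ in the mapping torus $M_\varphi$ with its complete hyperbolic metric. Choose $u_i,v_i\in\mathbb C-\{0\}$, $0\le i\le n$, with $$u_i^N=x_{(i)1},\qquad v_i^N=x_{(i)2},\qquad u_n=u_0,\qquad v_n=v_0 ;$$ equivalently, $u_0^N=x_{(0)1}$, $v_0^N=x_{(0)2}$,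 and for $1\le i\le n$ $$u_i^N=\frac{1}{u_{i-1}^Nv_{i-1}^N(1+u_{i-1}^{-N})^2},\qquad v_i^N=(1+u_{i-1}^N)^2v_{i-1}^N\qquad\text{if }A_i=R,$$ $$u_i^N=\frac{u_{i-1}^N}{(1+v_{i-1}^{-N})^2},\qquad v_i^N=\frac{(1+v_{i-1}^N)^2}{u_{i-1}^Nv_{i-1}^N}\qquad\text{if }A_i=L,$$ with $u_n=u_0$, $v_n=v_0$. Let $C_i=C_R(u_{i-1},v_{i-1},u_i,v_i,1)$ if $A_i=R$ and $C_i=C_L(u_{i-1},v_{i-1},u_i,v_i,1)$ if $A_i=L$, where $C_R(u,v,u',v',h)$ and $C_L(u,v,u'',v'',h)$ are the $N\times N$ matrices, with rows and columns indexed by $i,j\in\{0,\dots,N-1\}$, with entries $$C_R(u,v,u',v',h)_{ij}=q^{2(j-i)^2}\Big(\frac{u'v'}{uh}\Big)^{j-i}\Big(\frac{v'}{v}\Big)^i\prod_{\alpha=1}^{i}\frac{1}{(1+q^{4\alpha-3}u)(1+q^{4\alpha-1}u)},$$ $$C_L(u,v,u'',v'',h)_{ij}=\sum_{k=1}^N q^{4ik}\,q^{2(j-k)^2+2k^2}\Big(\frac{u''v''}{vh}\Big)^{j-k}\Big(\frac{uvv''}{h}\Big)^k\prod_{\alpha=1}^{k}\frac{1}{(1+q^{4\alpha-3}v)(1+q^{4\alpha-1}v)}.$$ Then the quantum hyperbolic invariant $C_\varphi$ of $\varphi$, which is a matrix in $\mathrm{GL}_N(\mathbb C)$ well defined up to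 conjugation and multiplication by a nonzero scalar, is represented by $$C_\varphi=C_1C_2\cdots C_n .$$
   Context: Ideal triangulations and slopes. An ideal triangulation $\lambda$ of $S$ is a triangulation of the closed torus with a single vertex, located at the puncture, considered up to isotopy; it has three edges and two triangles. Each edge has a slope in $\mathbb Q\cup\{\infty\}$ through $S\cong(\mathbb R^2-\mathbb Z^2)/\mathbb Z^2$ (slope $=y/x$, with $\infty$ the highest slope); matrices act on column vectors. The three edges occur in the same counterclockwise cyclic order around both triangles; for $\lambda_{(i)}$ the order $\lambda_{(i)1},\lambda_{(i)2},\lambda_{(i)3}$ is counterclockwise. Chekhov-Fock algebra. $\mathcal T^q_\lambda$ is the algebra generated by $X_e^{\pm1}$, $e$ an edge of $\lambda$, with relations $X_aX_b=q^{-4}X_bX_a$ whenever $b$ immediately follows $a$ counterclockwise around the triangles. For edges $e_1,e_2,e_3$ in counterclockwise order put $H=q^{2}X_{e_1}X_{e_2}X_{e_3}$, a central element. $\widehat{\mathcal T}^q_\lambda$ is its fraction division algebra. Coordinate changes. If $\lambda'$ is obtained from $\lambda$ by a diagonal exchange replacing the edge $e$ by the other diagonal $e'$ of the square formed by the two other edges, and if $e,a,b$ is the counterclockwise order of the edges of $\lambda$, then $\Phi^q_{\lambda\lambda'}:\widehat{\mathcal T}^q_{\lambda'}\to\widehat{\mathcal T}^q_\lambda$ is the isomorphism with $$X_{e'}\mapsto X_e^{-1},\quad X_a\mapsto(1+qX_e)(1+q^3X_e)X_a,\quad X_b\mapsto(1+qX_e^{-1})^{-1}(1+q^3X_e^{-1})^{-1}X_b.$$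 For arbitrary $\lambda,\lambda'$, $\Phi^q_{\lambda\lambda'}$ is defined by composing these along a sequence of diagonal exchanges using $\Phi^q_{\lambda\lambda''}=\Phi^q_{\lambda\lambda'}\circ\Phi^q_{\lambda'\lambda''}$ (known to be independent of the sequence). Pleated surfaces. $M_\varphi=S\times[0,1]/\sim$, with $(x,0)\sim(\varphi(x),1)$, oriented by the product orientation, carries a unique finite-volume complete hyperbolic metric. For an ideal triangulation $\lambda$ there is a unique pleated surface $f_\lambda:S\to M_\varphi$, homotopic to the inclusion $S=S\times\{0\}\to M_\varphi$, sending each face of $\lambda$ to a totally geodesic ideal triangle. Lift $f_\lambda$ to a map from the universal cover of $S$ to $\mathbb H^3$, with boundary $\mathbb C\cup\{\infty\}$. For an edge $e$ and an oriented lift of it, let $z_+,z_-$ be the positive and negative endpoints of its image, and $z_l,z_r$ the third vertices of the images of the triangles on its left and on its right. The exponential shear-bend parameter of $f_\lambda$ along $e$ is $$x_e=-\frac{(z_l-z_+)(z_r-z_-)}{(z_l-z_-)(z_r-z_+)}\in\mathbb C-\{0,-1\}.$$ The product of the three $x_e$ is $1$. Under a diagonal exchange from $\lambda$ to $\lambda'$ replacing $e$ by $e'$, with $e,a,b$ the counterclockwise order of the edges of $\lambda$, the weights $x$ for $\lambda$ and $x'$ for $\lambda'$ are related by $x'_{e'}=x_e^{-1}$, $x'_a=(1+x_e)^2x_a$, $x'_b=(1+x_e^{-1})^{-2}x_b$; and the weight of $\varphi(e)$ for $\varphi(\lambda)$ equals the weight of $e$ for $\lambda$. The invariant $C_\varphi$.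 Fix an ideal triangulation $\lambda$ of $S$ and let $x_e$, $e$ an edge of $\lambda$, be the exponential shear-bend parameters of the pleated surface $f_\lambda:S\to M_\varphi$. There is an irreducible representation $\rho:\mathcal T^q_\lambda\to\mathrm{End}(V)$, unique up to isomorphism and of dimension $N$, with $\rho(X_e^N)=x_e\,\mathrm{id}_V$ for every edge $e$ and $\rho(H)=\mathrm{id}_V$. The representation $\rho\circ\Phi^q_{\lambda\varphi(\lambda)}$ of $\mathcal T^q_{\varphi(\lambda)}$ is defined by applying to generators, step by step along a sequence of diagonal exchanges from $\lambda$ to $\varphi(\lambda)$, the formulas $X_{e'}\mapsto X_e^{-1}$, $X_a\mapsto(1+qX_e)(1+q^3X_e)X_a$, $X_b\mapsto(1+qX_e^{-1})^{-1}(1+q^3X_e^{-1})^{-1}X_b$ for each exchange replacing $e$ by $e'$, with $e,a,b$ in counterclockwise order (the factors to be inverted are sent to invertible operators). Let $\Phi:\mathcal T^q_{\varphi(\lambda)}\to\mathcal T^q_\lambda$ be the isomorphism $X_{\varphi(e)}\mapsto X_e$. Then $\rho\circ\Phi^q_{\lambda\varphi(\lambda)}$ and $\rho\circ\Phi$ are isomorphic irreducible representations, and $C_\varphi\in\mathrm{GL}(V)$ is defined by $$\rho\circ\Phi^q_{\lambda\varphi(\lambda)}(X)=C_\varphi\cdot(\rho\circ\Phi(X))\cdot C_\varphi^{-1}\qquad\forall X\in\mathcal T^q_{\varphi(\lambda)}.$$ It is known that, up to conjugation and scalar multiplication, $C_\varphi$ depends only on $q$ and $\varphi$. *)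

(* Defs.v *)
From HB Require Import structures.
From mathcomp Require Import all_boot all_order all_algebra.
From mathcomp Require Import all_classical all_reals all_analysis.
From mathcomp Require Import complex.
Import Order.TTheory GRing.Theory Num.Theory.
Import numFieldNormedType.Exports.

Set Implicit Arguments.
Unset Strict Implicit.
Unset Printing Implicit Defensive.

Local Open Scope classical_set_scope.
Local Open Scope ring_scope.
Local Open Scope complex_scope.

(* The complex numbers are R[i], for R : realType. *)

(* None is the slope oo. *)
Definition slope := option rat.

Definition slope_of (v : 'cV[int]_2) : slope :=
  if v 0 0 == 0 then None else Some ((v 1 0)%:Q / (v 0 0)%:Q).

(* One of the two primitive integer vectors of slope s. *)
Definition slope_vector (s : slope) : 'cV[int]_2 :=
  \col_(i < 2) match s with
               | None => if i == 0 then 0 else 1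
               | Some r => if i == 0 then denq r else numq r
               end.

Definition slope_act (A : 'M[int]_2) (s : slope) : slope :=
  slope_of (A *m slope_vector s).

Definition triangulation := (slope * slope * slope)%type.

Definition triangulation_act (A : 'M[int]_2) (l : triangulation) : triangulation :=
  (slope_act A l.1.1, slope_act A l.1.2, slope_act A l.2).

Definition edge_of (l : triangulation) (s : slope) : Prop :=
  [\/ s = l.1.1, s = l.1.2 | s = l.2].

(* The edges of slopes l.1.1, l.1.2, l.2, in this order, bound counterclockwise
   the triangle with successive side vectors v, w, -(v + w), which is positively
   oriented and has area 1/2.  The other face is the image of this one under
   a rotation of angle pi, so that its edges come in the same cyclic order. *)
Definition side_vectors (l : triangulation) (v w : 'cV[int]_2) : Prop :=
  [/\ slope_of v = l.1.1, slope_of w = l.1.2, slope_of (v + w) = l.2 &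
      v 0 0 * w 1 0 - v 1 0 * w 0 0 = 1].

(* Ideal triangulations come with a choice of a first edge and list their edges
   counterclockwise: the three cyclic rotations of a triple are the same
   triangulation. *)
Definition ideal_triangulation (l : triangulation) : Prop :=
  exists v w : 'cV[int]_2, side_vectors l v w.

(* There are only two ideal triangulations containing a and b; the edges follow
   each other as e, a, b in one of them and as e', b, a in the other. *)
Definition diagonal_exchange (e a b e' : slope) : Prop :=
  ideal_triangulation (e, a, b) /\ ideal_triangulation (e', b, a).

Definition lambda0 : triangulation := (Some 0, None, Some 1).

Inductive letter := LetterR | LetterL.

Definition letter_mx (a : letter) : 'M[int]_2 :=
  match a with
  | LetterR => \matrix_(i < 2, j < 2) (if (i == 0) && (j == 1) then 0 else 1)
  | LetterL => \matrix_(i < 2, j < 2) (if (i == 1) && (j == 0) then 0 else 1)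
  end.

(* A representation of the algebra presented by generators X_e^{+-1} and
   relations is given by the images X e of the generators; only the values of X
   at the edges of the triangulation are meaningful. *)
Definition CF_representation (F : fieldType) (N : nat) (q : F)
    (l : triangulation) (X : slope -> 'M[F]_N) : Prop :=
  [/\ forall e, edge_of l e -> X e \in unitmx,
      X l.1.1 *m X l.1.2 = q ^- 4 *: (X l.1.2 *m X l.1.1),
      X l.1.2 *m X l.2 = q ^- 4 *: (X l.2 *m X l.1.2) &
      X l.2 *m X l.1.1 = q ^- 4 *: (X l.1.1 *m X l.2)].

(* Operators act on column vectors, and U stands for its column space. *)
Definition CF_irreducible (F : fieldType) (N : nat)
    (l : triangulation) (X : slope -> 'M[F]_N) : Prop :=
  (0 < N)%N /\
  forall U : 'M[F]_N,
    (forall e, edge_of l e -> exists W : 'M[F]_N, X e *m U = U *m W) ->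
    \rank U = 0%N \/ \rank U = N.

Definition mxpow (F : fieldType) (N : nat) (M : 'M[F]_N) (k : nat) : 'M[F]_N :=
  iter k (mulmx M) 1%:M.

Definition CF_irrep_with_weights (F : fieldType) (N : nat) (q : F)
    (l : triangulation) (x : slope -> F) (X : slope -> 'M[F]_N) : Prop :=
  [/\ CF_representation q l X,
      CF_irreducible l X,
      forall e, edge_of l e -> mxpow (X e) N = (x e)%:M &
      q ^+ 2 *: (X l.1.1 *m X l.1.2 *m X l.2) = 1%:M].

(* X' is the composition of the representation X of the algebra of (e, a, b)
   with the coordinate change to (e', b, a). *)
Definition CF_exchange (F : fieldType) (N : nat) (q : F)
    (e a b e' : slope) (X X' : slope -> 'M[F]_N) : Prop :=
  let Y := invmx (X e) in
  [/\ [/\ 1%:M + q *: X e \in unitmx, 1%:M + q ^+ 3 *: X e \in unitmx,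
          1%:M + q *: Y \in unitmx & 1%:M + q ^+ 3 *: Y \in unitmx],
      X' e' = Y,
      X' a = (1%:M + q *: X e) *m (1%:M + q ^+ 3 *: X e) *m X a &
      X' b = invmx (1%:M + q *: Y) *m invmx (1%:M + q ^+ 3 *: Y) *m X b].

(* CF_transport q l X l' X': the representation X' of the algebra of l' is
   obtained from the representation X of the algebra of l by composition with
   the coordinate changes along some sequence of diagonal exchanges. *)
Inductive CF_transport (F : fieldType) (N : nat) (q : F)
    (l : triangulation) (X : slope -> 'M[F]_N) :
    triangulation -> (slope -> 'M[F]_N) -> Prop :=
| CF_transport_refl : CF_transport q l X l X
| CF_transport_rotate (e a b : slope) (Y : slope -> 'M[F]_N) :
    CF_transport q l X (e, a, b) Y -> CF_transport q l X (a, b, e) Y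
| CF_transport_exchange (e a b e' : slope) (Y Z : slope -> 'M[F]_N) :
    CF_transport q l X (e, a, b) Y ->
    diagonal_exchange e a b e' -> CF_exchange q e a b e' Y Z ->
    CF_transport q l X (e', b, a) Z.

(* C intertwines the two representations of the algebra of A(l) obtained from X,
   one by coordinate changes and the other by the relabelling A(e) |-> e. *)
Definition quantum_invariant (F : fieldType) (N : nat) (q : F) (A : 'M[int]_2)
    (l : triangulation) (X : slope -> 'M[F]_N) (C : 'M[F]_N) : Prop :=
  C \in unitmx /\
  exists X' : slope -> 'M[F]_N,
    CF_transport q l X (triangulation_act A l) X' /\
    forall e, edge_of l e -> X' (slope_act A e) = C *m X e *m invmx C.

Definition conj_up_to_scalar (F : fieldType) (N : nat) (C D : 'M[F]_N) : Prop :=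
  exists (c : F) (P : 'M[F]_N),
    [/\ c != 0, P \in unitmx & C = c *: (P *m D *m invmx P)].

Definition mxC_R (F : fieldType) (N : nat) (q u v u' v' h : F) : 'M[F]_N :=
  \matrix_(i < N, j < N)
    (q ^ (2 * (j%:Z - i%:Z) ^+ 2) * (u' * v' / (u * h)) ^ (j%:Z - i%:Z)
     * (v' / v) ^+ i
     * \prod_(1 <= a < i.+1)
         ((1 + q ^+ (4 * a - 3) * u) * (1 + q ^+ (4 * a - 1) * u))^-1).

Definition mxC_L (F : fieldType) (N : nat) (q u v u'' v'' h : F) : 'M[F]_N :=
  \matrix_(i < N, j < N)
    \sum_(1 <= k < N.+1)
      (q ^+ (4 * i * k) * q ^ (2 * (j%:Z - k%:Z) ^+ 2 + 2 * k%:Z ^+ 2)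
       * (u'' * v'' / (v * h)) ^ (j%:Z - k%:Z) * (u * v * v'' / h) ^+ k
       * \prod_(1 <= a < k.+1)
           ((1 + q ^+ (4 * a - 3) * v) * (1 + q ^+ (4 * a - 1) * v))^-1).

Definition mxC_letter (F : fieldType) (N : nat) (q : F) (a : letter) :
    F -> F -> F -> F -> F -> 'M[F]_N :=
  match a with LetterR => mxC_R N q | LetterL => mxC_L N q end.

Definition lattice_point (R : realType) (v : 'cV[int]_2) : 'rV[R]_2 :=
  (map_mx intr v)^T.

Definition punctured_plane (R : realType) : set 'rV[R]_2 :=
  [set x | forall v, x <> lattice_point R v].

Definition C1_orientation_preserving (R : realType) (n : nat)
    (D : set 'rV[R]_n.+1) (f : 'rV[R]_n.+1 -> 'rV[R]_n.+1) : Prop :=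
  forall x, D x ->
    [/\ differentiable f x, {for x, continuous (jacobian f)} &
        0 < \det (jacobian f x)].

(* phi is a lift to R^2 - Z^2 of an orientation-preserving diffeomorphism of S.
   Such lifts exist since R^2 - Z^2 -> S is the covering of the commutator
   subgroup of the fundamental group, and H_1(S) = Z^2 is its deck group, so that
   A is the action of the diffeomorphism on H_1(S). *)
Definition lift_of_diffeo (R : realType) (A : 'M[int]_2)
    (phi : 'rV[R]_2 -> 'rV[R]_2) : Prop :=
  [/\ set_bij (@punctured_plane R) (@punctured_plane R) phi,
      C1_orientation_preserving (@punctured_plane R) phi &
      forall x v, punctured_plane x ->
        phi (x + lattice_point R v) = phi x + lattice_point R (A *m v)].

(* The isotopy class of diffeomorphisms of S acting by A on H_1(S) contains the
   linear map A.  It is pseudo-Anosov when this map multiplies by k > 1 and by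
   k^-1 the transverse measures |wu.dx| and |ws.dx| of two linear foliations. *)
Definition pseudo_Anosov_class (R : realType) (A : 'M[int]_2) : Prop :=
  exists (k : R) (wu ws : 'rV[R]_2) (su ss : bool),
    [/\ 1 < k, wu != 0, ws != 0,
        wu *m map_mx intr A = ((-1) ^+ su * k) *: wu &
        ws *m map_mx intr A = ((-1) ^+ ss * k^-1) *: ws].

(* The upper half-space model, with coordinates (Re z, Im z, t) and the
   orientation given by these coordinates. *)
Definition H3 (R : realType) : set 'rV[R]_3 := [set x | 0 < x 0 ord_max].

Definition point3 (R : realType) (a b t : R) : 'rV[R]_3 :=
  \row_(i < 3) [:: a; b; t]`_i.

(* The isometry of H3 extending the homography z |-> (a z + b) / (c z + d), for
   a matrix of determinant 1. *)
Definition isom3 (R : realType) (g : 'M[R[i]]_2) (x : 'rV[R]_3) : 'rV[R]_3 :=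
  let z := x 0 0 +i* x 0 1 in
  let t := x 0 ord_max in
  let a := g 0 0 in let b := g 0 1 in let c := g 1 0 in let d := g 1 1 in
  let num := (a * z + b) * conjc (c * z + d) + a * conjc c * (t ^+ 2)%:C in
  let den := complex.Re ((c * z + d) * conjc (c * z + d)
                         + c * conjc c * (t ^+ 2)%:C) in
  point3 (complex.Re num / den) (complex.Im num / den) (t / den).

(* The ideal triangle with vertices 0, oo, 1, and its three sides. *)
Definition std_ideal_triangle (R : realType) : set 'rV[R]_3 :=
  [set x | exists a t : R, [/\ 0 < t, 0 <= a <= 1, a <= a ^+ 2 + t ^+ 2 &
                               x = point3 a 0 t]].

Definition std_side_0_oo (R : realType) : set 'rV[R]_3 :=
  [set x | exists t : R, 0 < t /\ x = point3 0 0 t].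

Definition std_side_1_oo (R : realType) : set 'rV[R]_3 :=
  [set x | exists t : R, 0 < t /\ x = point3 1 0 t].

Definition std_side_0_1 (R : realType) : set 'rV[R]_3 :=
  [set x | exists a t : R, [/\ 0 < t, a = a ^+ 2 + t ^+ 2 & x = point3 a 0 t]].

(* Points of the boundary C u {oo} of H3 are given by homogeneous coordinates;
   for finite points [z : 1], [w : 1] this is z - w. *)
Definition hdiff (R : realType) (z w : 'cV[R[i]]_2) : R[i] :=
  z 0 0 * w 1 0 - z 1 0 * w 0 0.

Definition shear_bend_parameter (R : realType) (zp zm zl zr : 'cV[R[i]]_2) : R[i] :=
  - (hdiff zl zp * hdiff zr zm / (hdiff zl zm * hdiff zr zp)).

(* M_phi is the quotient of (R^2 - Z^2) x R, whose points are written as rows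
   (x, t), by the group generated by the translations (x, t) |-> (x + v, t), for
   v in Z^2, and by (x, t) |-> (phi x, t + 1). *)
Definition space_point (R : realType) (x : 'rV[R]_2) (t : R) : 'rV[R]_3 :=
  row_mx x (t%:M : 'rV[R]_1).

Definition torus_part (R : realType) (y : 'rV[R]_3) : 'rV[R]_2 :=
  @lsubmx R 1 2 1 y.

Definition mapping_torus_step (R : realType) (phi : 'rV[R]_2 -> 'rV[R]_2)
    (y y' : 'rV[R]_3) : Prop :=
  exists (m : nat) (v : 'cV[int]_2),
    torus_part y' = iter m phi (torus_part y) + lattice_point R v /\
    y' 0 ord_max = y 0 ord_max + m%:R.

Definition mapping_torus_eq (R : realType) (phi : 'rV[R]_2 -> 'rV[R]_2)
    (y y' : 'rV[R]_3) : Prop :=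
  mapping_torus_step phi y y' \/ mapping_torus_step phi y' y.

Definition holonomy_group (R : realType) (phi : 'rV[R]_2 -> 'rV[R]_2)
    (p : 'rV[R]_3 -> 'rV[R]_3) : set 'M[R[i]]_2 :=
  [set g | \det g = 1 /\
           forall x, H3 x -> mapping_torus_eq phi (p x) (p (isom3 g x))].

Definition finite_covolume (R : realType) (G : set 'M[R[i]]_2) : Prop :=
  exists D : set (R * R * R),
    [/\ measurable D,
        forall w, D w -> 0 < w.2,
        forall x, H3 x -> exists g w,
          [/\ G g, D w & x = isom3 g (point3 w.1.1 w.1.2 w.2)] &
        (\int[(lebesgue_measure \x lebesgue_measure) \x lebesgue_measure]_(w in D)
           ((w.2 ^- 3)%:E) < +oo)%E].

(* A complete hyperbolic metric on M_phi is an orientation-preserving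
   identification of M_phi with the quotient of H3 by a group of isometries.  The
   projection H3 -> M_phi is given by its lift p to (R^2 - Z^2) x R, which is
   the universal covering of the latter. *)
Definition hyperbolic_structure (R : realType) (phi : 'rV[R]_2 -> 'rV[R]_2)
    (p : 'rV[R]_3 -> 'rV[R]_3) : Prop :=
  [/\ forall x, H3 x -> punctured_plane (torus_part (p x)),
      forall x t, punctured_plane x -> exists2 y, H3 y & p y = space_point x t,
      C1_orientation_preserving (@H3 R) p,
      forall x y, H3 x -> H3 y -> mapping_torus_eq phi (p x) (p y) ->
        exists2 g, holonomy_group phi p g & y = isom3 g x &
      finite_covolume (holonomy_group phi p)].

(* As (R^2 - Z^2) x {0} -> (R^2 - Z^2) x R is a homotopy equivalence, the inverse
   image of (R^2 - Z^2) x {0} is the universal covering of S = S x {0}, and its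
   deck group is the group of the isometries which act on (R^2 - Z^2) x R by
   translations by elements of Z^2. *)
Definition surface_cover (R : realType) (p : 'rV[R]_3 -> 'rV[R]_3) : set 'rV[R]_3 :=
  [set x | H3 x /\ p x 0 ord_max = 0].

Definition surface_group (R : realType) (p : 'rV[R]_3 -> 'rV[R]_3) :
    set 'M[R[i]]_2 :=
  [set g | \det g = 1 /\ exists v : 'cV[int]_2, forall x, H3 x ->
           p (isom3 g x) = p x + space_point (lattice_point R v) 0].

Definition triangle (R : realType) (a b c : 'rV[R]_2) : set 'rV[R]_2 :=
  [set x | exists r s t : R,
     [/\ 0 <= r < 1, 0 <= s < 1, 0 <= t < 1, r + s + t = 1 &
         x = r *: a + s *: b + t *: c]].

Definition open_segment (R : realType) (a b : 'rV[R]_2) : set 'rV[R]_2 :=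
  [set x | exists r : R, 0 < r < 1 /\ x = (1 - r) *: a + r *: b].

Definition surface_lift (R : realType) (p : 'rV[R]_3 -> 'rV[R]_3)
    (T : set 'rV[R]_2) (s : 'rV[R]_2 -> 'rV[R]_3) : Prop :=
  {within T, continuous s} /\ forall x, T x -> H3 (s x) /\ p (s x) = space_point x 0.

(* h sends the triangle with its vertices a, b, c removed to the ideal triangle
   with vertices g(0), g(oo), g(1), respectively. *)
Definition onto_ideal_triangle (R : realType) (h : 'rV[R]_2 -> 'rV[R]_3)
    (a b c : 'rV[R]_2) (g : 'M[R[i]]_2) : Prop :=
  [/\ \det g = 1,
      set_bij (triangle a b c) (isom3 g @` @std_ideal_triangle R) h,
      h @` open_segment a b = isom3 g @` @std_side_0_oo R,
      h @` open_segment b c = isom3 g @` @std_side_1_oo R &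
      h @` open_segment a c = isom3 g @` @std_side_0_1 R].

(* f is the lift to universal coverings of a pleated surface S -> M_phi with
   pleating locus l; f being equivariant means that this pleated surface is
   homotopic to the inclusion of S = S x {0}.  The lifts to R^2 of the faces of l
   are the triangles m, m + v, m + v + w and m, m + v, m - w, for m in Z^2. *)
Definition pleated_surface (R : realType) (p : 'rV[R]_3 -> 'rV[R]_3)
    (l : triangulation) (f : 'rV[R]_3 -> 'rV[R]_3) : Prop :=
  [/\ forall x, surface_cover p x -> H3 (f x),
      {within surface_cover p, continuous f},
      forall g x, surface_group p g -> surface_cover p x ->
        f (isom3 g x) = isom3 g (f x) &
      forall m v w k : 'cV[int]_2, side_vectors l v w ->
        k = m + v + w \/ k = m - w ->
        let a := lattice_point R m in
        let b := lattice_point R (m + v) in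
        let c := lattice_point R k in
        forall s, surface_lift p (triangle a b c) s ->
        exists g, onto_ideal_triangle (f \o s) a b c g].

(* y is the exponential shear-bend parameter of f along the edge l.1.1, oriented
   from m to m + v: the face m, m + v, m + v + w is on its left and the face
   m, m + v, m - w is on its right.  The coordinates of g(0), g(oo), g(1) are
   g (0, 1), g (1, 0), g (1, 1). *)
Definition is_shear_bend (R : realType) (p : 'rV[R]_3 -> 'rV[R]_3)
    (l : triangulation) (f : 'rV[R]_3 -> 'rV[R]_3) (y : R[i]) : Prop :=
  exists (m v w : 'cV[int]_2) (s : 'rV[R]_2 -> 'rV[R]_3) (gl gr : 'M[R[i]]_2),
    let a := lattice_point R m in
    let b := lattice_point R (m + v) in
    let cl := lattice_point R (m + v + w) in
    let cr := lattice_point R (m - w) in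
    [/\ side_vectors l v w,
        surface_lift p (triangle a b cl `|` triangle a b cr) s,
        onto_ideal_triangle (f \o s) a b cl gl,
        onto_ideal_triangle (f \o s) a b cr gr &
        y = shear_bend_parameter (col 0 gl) (col 1 gl)
              (col 0 gl + col 1 gl) (col 0 gr + col 1 gr)].

Definition shear_bend_weights (R : realType) (p : 'rV[R]_3 -> 'rV[R]_3)
    (l : triangulation) (f : 'rV[R]_3 -> 'rV[R]_3) (x : slope -> R[i]) : Prop :=
  [/\ is_shear_bend p l f (x l.1.1),
      is_shear_bend p (l.1.2, l.2, l.1.1) f (x l.1.2) &
      is_shear_bend p (l.2, l.1.1, l.1.2) f (x l.2)].

(* Main.v *)
(* Put X_1 = u diag(q^(4i)), X_2 = v times the cyclic shift and
   X_3 = (q^2 X_1 X_2)^-1.  Up to conjugation this is the only N-dimensional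
   representation with X_1^N = u^N, X_2^N = v^N and H = 1, and it is irreducible.
   The matrices C_R and C_L intertwine the standard representation of parameters
   (u', v') with the coordinate change of the one of parameters (u, v); hence
   C_1 ... C_n intertwines the two representations defining C_phi and, by Schur's
   lemma, it is the only such matrix up to scalars.
   Coordinate changes do not depend on the sequence of exchanges because the
   triangulations form a tree and going back and forth along an edge of the tree
   gives the identity.  Acyclicity is seen on the values of x^2 - xy + y^2 at the
   slopes: when e is exchanged for e', with a and b the two other edges, the values
   at e and e' add up to twice the sum of those at a and b, and are distinct; at
   most one edge of a triangulation has a value greater than the sum of the two
   others, so at most one exchange decreases the values. *)

Require Import Defs.
From mathcomp Require Import all_boot all_order all_algebra.
From mathcomp Require Import all_classical all_reals all_analysis.
From mathcomp Require Import complex.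
From mathcomp Require Import ring zify.
Import Order.TTheory GRing.Theory Num.Theory.
Import numFieldNormedType.Exports.
Local Open Scope ring_scope.
Local Open Scope complex_scope.

Set Implicit Arguments.
Unset Strict Implicit.
Unset Printing Implicit Defensive.

Lemma iter_mulmxE (F : fieldType) (N : nat) (M : 'M[F]_N) k :
  mxpow M k = M ^+ k.
Proof. by elim: k => [//|k IHk]; rewrite exprS -IHk. Qed.

(** * Standard representations and their intertwiners *)

Section StandardRepresentation.

Variables (F : fieldType) (N : nat) (q : F).
Hypotheses (Nodd : odd N) (qprim : N.-primitive_root q).

Lemma expr_eq1_neq0 (c : F) : c ^+ N = 1 -> c != 0.
Proof.
apply: contra_eq_neq => ->; rewrite expr0n; case: N Nodd => // n _.
by rewrite eq_sym oner_eq0.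
Qed.

Lemma q_neq0 : q != 0.
Proof. exact: expr_eq1_neq0 (prim_expr_order qprim). Qed.

(** An odd N is prime to 4, so raising to the fourth power permutes the N-th roots of unity. *)
Lemma q4_prim : N.-primitive_root (q ^+ 4).
Proof.
by rewrite (prim_root_exp_coprime 4 qprim) (coprimeXl 2 (m := 2)) // coprime2n.
Qed.

Lemma expr_ordS (z : F) (i : 'I_N) : z ^+ N = 1 -> z ^+ ordS i = z ^+ i.+1.
Proof. by move=> zN /=; rewrite expr_mod. Qed.

(** Evaluate the factorisation of X^N - 1 at X = -1/t and multiply by (-t)^N; the signs match
    because N is odd. *)
Lemma prod_add1_root (z t : F) :
  N.-primitive_root z -> \prod_(0 <= a < N) (1 + z ^+ a * t) = 1 + t ^+ N.
Proof.
move=> zprim.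
have [-> | tn0] := eqVneq t 0.
  rewrite expr0n big1 => [|a _]; last by rewrite mulr0 addr0.
  by case: N Nodd => //=; rewrite addr0.
have /(congr1 (fun p => p.[- t^-1])) := factor_Xn_sub_1 zprim.
rewrite horner_prod !hornerE => e.
have {}e : \prod_(0 <= a < N) (- t^-1 - z ^+ a) = - t ^- N - 1.
  rewrite -(_ : (- t^-1) ^+ N - 1 = - t ^- N - 1); last first.
    by rewrite exprNn -signr_odd Nodd expr1 mulN1r exprVn.
  by rewrite -e; apply: eq_bigr => a _; rewrite !hornerE.
have eN : \prod_(0 <= a < N) (- t) = - t ^+ N.
  by rewrite big_const_nat subn0 iter_mulr_1 exprNn -signr_odd Nodd expr1 mulN1r.
transitivity (\prod_(0 <= a < N) (- t * (- t^-1 - z ^+ a))).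
  by apply: eq_bigr => a _; field.
rewrite big_split /= e eN; field.
by rewrite expf_neq0.
Qed.

Definition std1 (u : F) : 'M[F]_N :=
  \matrix_(i < N, j < N) (if i == j then u * q ^+ (4 * i) else 0).

Definition std2 (v : F) : 'M[F]_N :=
  \matrix_(i < N, j < N) (if j == ordS i then v else 0).

Definition std3 (u v : F) : 'M[F]_N :=
  \matrix_(i < N, j < N)
    (if i == ordS j then (q ^+ (2 + 4 * j) * u * v)^-1 else 0).

Lemma mul_std1 u (M : 'M[F]_N) i j : (std1 u *m M) i j = u * q ^+ (4 * i) * M i j.
Proof.
rewrite mxE (bigD1 i) //= mxE eqxx big1 ?addr0 // => k /negPf ki.
by rewrite mxE eq_sym ki mul0r.
Qed.

Lemma mulmx_std1 u (M : 'M[F]_N) i j :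
  (M *m std1 u) i j = M i j * (u * q ^+ (4 * j)).
Proof.
rewrite mxE (bigD1 j) //= mxE eqxx big1 ?addr0 // => k /negPf kj.
by rewrite mxE kj mulr0.
Qed.

Lemma mul_std2 v (M : 'M[F]_N) i j : (std2 v *m M) i j = v * M (ordS i) j.
Proof.
rewrite mxE (bigD1 (ordS i)) //= mxE eqxx big1 ?addr0 // => k /negPf ki.
by rewrite mxE ki mul0r.
Qed.

Lemma mulmx_std2 v (M : 'M[F]_N) i j : (M *m std2 v) i (ordS j) = M i j * v.
Proof.
rewrite mxE (bigD1 j) //= mxE eqxx big1 ?addr0 // => k /negPf kj.
by rewrite mxE (inj_eq (@ordS_inj N)) eq_sym kj mulr0.
Qed.

Lemma mul_std3 u v (M : 'M[F]_N) i j :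
  (std3 u v *m M) (ordS i) j = (q ^+ (2 + 4 * i) * u * v)^-1 * M i j.
Proof.
rewrite mxE (bigD1 i) //= mxE eqxx big1 ?addr0 // => k /negPf ki.
by rewrite mxE (inj_eq (@ordS_inj N)) eq_sym ki mul0r.
Qed.

Lemma mulmx_std3 u v (M : 'M[F]_N) i j :
  (M *m std3 u v) i j = M i (ordS j) * (q ^+ (2 + 4 * j) * u * v)^-1.
Proof.
rewrite mxE (bigD1 (ordS j)) //= mxE eqxx big1 ?addr0 // => k /negPf kj.
by rewrite mxE kj mulr0.
Qed.

Lemma q4_ordS (i : 'I_N) : q ^+ (4 * ordS i) = q ^+ (4 * i) * q ^+ 4.
Proof.
rewrite !exprM expr_ordS; first by rewrite -exprSr.
exact: (prim_expr_order q4_prim).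
Qed.

Lemma std_H u v : u != 0 -> v != 0 ->
  q ^+ 2 *: (std1 u *m std2 v *m std3 u v) = 1%:M.
Proof.
move=> u0 v0; apply/matrixP => i j.
rewrite mxE -mulmxA mul_std1 mul_std2 !mxE (inj_eq (@ordS_inj N)).
case: eqP => [->|_]; last by rewrite !mulr0.
rewrite exprD /=; have q0 := q_neq0.
by field; rewrite v0 u0 !expf_neq0.
Qed.

Lemma std12 u v : std1 u *m std2 v = q ^- 4 *: (std2 v *m std1 u).
Proof.
apply/matrixP => i j; rewrite [RHS]mxE mul_std1 mul_std2 !mxE (eq_sym (ordS i)).
case: (j =P ordS i) => [_|_]; last by rewrite !mulr0.
by rewrite q4_ordS; field; rewrite q_neq0.
Qed.

Lemma iter_ordS k (i : 'I_N) : iter k (@ordS N) i = ((i + k) %% N)%N :> nat.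
Proof.
elim: k => [|k IHk] /=; first by rewrite addn0 modn_small.
by rewrite IHk -addn1 modnDml addn1 addnS.
Qed.

Lemma std1X u k : std1 u ^+ k =
  \matrix_(i < N, j < N) (if i == j then (u * q ^+ (4 * i)) ^+ k else 0).
Proof.
elim: k => [|k IHk]; apply/matrixP => i j.
  by rewrite expr0 !mxE expr0; case: eqP.
by rewrite exprS [LHS]mul_std1 IHk !mxE; case: eqP => _; rewrite ?mulr0 -?exprS.
Qed.

Lemma std1N u : std1 u ^+ N = (u ^+ N)%:M.
Proof.
apply/matrixP => i j; rewrite std1X !mxE; case: eqP => _ //.
by rewrite exprMn exprAC (prim_expr_order qprim) expr1n mulr1.
Qed.

Lemma std2X v k i j :
  (std2 v ^+ k) i j = if j == iter k (@ordS N) i then v ^+ k else 0.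
Proof.
elim: k i => [|k IHk] i; first by rewrite expr0 !mxE eq_sym; case: eqP.
rewrite exprS [LHS]mul_std2 IHk -iterSr /=.
by case: eqP => _; rewrite ?mulr0 -?exprS.
Qed.

Lemma std2N v : std2 v ^+ N = (v ^+ N)%:M.
Proof.
apply/matrixP => i j; rewrite std2X !mxE eq_sym.
suff -> : iter N (@ordS N) i = i by case: eqP.
by apply: val_inj; rewrite /= iter_ordS modnDr modn_small.
Qed.

Lemma sum_expr_root_neq1 (y : F) :
  y ^+ N = 1 -> y != 1 -> \sum_(k < N) y ^+ k = 0.
Proof.
move=> yN y1; have := subrX1 y N; rewrite yN subrr => /esym/eqP.
by rewrite mulf_eq0 subr_eq0 (negPf y1) => /eqP.
Qed.

Lemma q4X_inj (i j : 'I_N) : q ^+ (4 * i) / q ^+ (4 * j) = 1 -> i = j.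
Proof.
move=> /divr1_eq; rewrite !exprM => /eqP.
rewrite (eq_prim_root_expr q4_prim) !modn_small // => /eqP.
exact: val_inj.
Qed.

(* The operators [std1 u] separate the vectors of the canonical basis, which
   [std2 v] permutes cyclically; hence a kernel stable under both is trivial. *)
Lemma std_intertwiner (M Y1 Y2 : 'M[F]_N) u v :
    u != 0 -> v != 0 -> M != 0 ->
    M *m std1 u = Y1 *m M -> M *m std2 v = Y2 *m M ->
  M \in unitmx.
Proof.
move=> u0 v0 M0 M1 M2; apply: contraNT M0.
rewrite unitmxE unitfE negbK -det_tr => /det0P[z z0 zM].
have {}zM : M *m z^T = 0 by rewrite -[M]trmxK -trmx_mul zM trmx0.
have [j zj] : exists j, z 0 j != 0.
  apply/existsP; apply: contraNT z0; rewrite negb_exists => /forallP z0.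
  by apply/eqP/rowP => j; rewrite mxE; apply/eqP; rewrite -[_ == _]negbK.
have MX k : M *m (std1 u ^+ k *m z^T) = 0.
  elim: k => [|k IHk]; first by rewrite expr0 mul1mx.
  by rewrite exprS -[_ * _]/(_ *m _) -mulmxA mulmxA M1 -mulmxA IHk mulmx0.
(* Summing the powers of [std1 u], each divided by the same power of its j-th eigenvalue, projects
   the kernel vector onto the j-th basis vector, up to the factor N * z_j, which is nonzero in F. *)
have Mj : col j M = 0.
  have: \sum_(k < N) (u * q ^+ (4 * j)) ^- k *: (M *m (std1 u ^+ k *m z^T)) = 0.
    by rewrite big1 // => k _; rewrite MX scaler0.
  under eq_bigr do rewrite scalemxAr.
  rewrite -mulmx_sumr => sum0.
  have sumE : \sum_(k < N) (u * q ^+ (4 * j)) ^- k *: (std1 u ^+ k *m z^T)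
      = (N%:R * z 0 j) *: delta_mx j 0.
    apply/colP => i; rewrite summxE.
    transitivity (\sum_(k < N) (q ^+ (4 * i) / q ^+ (4 * j)) ^+ k * z 0 i).
      apply: eq_bigr => k _; rewrite !mxE (bigD1 i) //= std1X !mxE eqxx.
      rewrite big1 => [|l /negPf li]; last by rewrite mxE eq_sym li mul0r.
      rewrite !expr_div_n !exprMn; field.
      by rewrite !expf_neq0 // q_neq0.
    rewrite -mulr_suml !mxE eqxx andbT; have [->|ij] := eqVneq i j.
      rewrite divff ?expf_neq0 ?q_neq0 //.
      under eq_bigr do rewrite expr1n.
      by rewrite sumr_const card_ord mulr1.
    rewrite sum_expr_root_neq1 ?mul0r ?mulr0 //.
      by rewrite expr_div_n !(exprAC _ _ N) (prim_expr_order qprim) !expr1n divr1.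
    by apply: contra_neq ij => /q4X_inj.
  move: sum0; rewrite sumE -scalemxAr -colE => /eqP.
  rewrite scaler_eq0 mulf_eq0 (negPf zj) (negPf (prim_root_natf_neq0 qprim)).
  by move/eqP.
have Mstep i : col (ordS i) M = 0 -> col i M = 0.
  move=> Mi; apply/colP => a; rewrite !mxE; apply: (mulIf v0).
  rewrite -mulmx_std2 M2 mul0r !mxE big1 // => b _.
  by have /colP/(_ b) := Mi; rewrite !mxE => ->; rewrite mulr0.
have Miter k i : col (iter k (@ordS N) i) M = 0 -> col i M = 0.
  by elim: k i => [//|k IHk] i; rewrite iterSr => /IHk/Mstep.
apply/eqP/matrixP => a i; rewrite mxE.
suff /colP/(_ a) : col i M = 0 by rewrite !mxE.
(* The number of cyclic shifts leading from i to j, with N - i standing for -i modulo N. *)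
apply: (Miter (j + (N - i))%N).
suff -> : iter (j + (N - i)) (@ordS N) i = j by [].
apply: val_inj; rewrite /= iter_ordS addnCA subnKC 1?ltnW //.
by rewrite modnDr modn_small.
Qed.

(** * Dilogarithm and Gaussian factors of the matrix entries *)

Lemma add1_neq0 (z t : F) : z ^+ N = 1 -> 1 + t ^+ N != 0 -> 1 + z * t != 0.
Proof.
move=> zN; apply: contra_neq => /eqP; rewrite addrC addr_eq0 => /eqP e.
have -> : t ^+ N = (z * t) ^+ N by rewrite exprMn zN mul1r.
by rewrite e -signr_odd Nodd expr1 subrr.
Qed.

Lemma qX_N k : (q ^+ k) ^+ N = 1.
Proof. by rewrite exprAC (prim_expr_order qprim) expr1n. Qed.

(** The cyclic quantum dilogarithm that enters both [mxC_R] and [mxC_L]. *)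
Definition dilog u k : F :=
  \prod_(1 <= a < k.+1)
    ((1 + q ^+ (4 * a - 3) * u) * (1 + q ^+ (4 * a - 1) * u))^-1.

Lemma dilogS u k : dilog u k.+1 =
  dilog u k / ((1 + q ^+ (4 * k + 1) * u) * (1 + q ^+ (4 * k + 3) * u)).
Proof.
rewrite /dilog big_nat_recr //=.
congr (_ / ((1 + q ^+ _ * u) * (1 + q ^+ _ * u))).
  by lia.
by lia.
Qed.

(** Over a full period q^(4a) runs through all N-th roots of unity, so each of the two families of
    factors multiplies to 1 + u^N. *)
Lemma dilogN u : dilog u N = (1 + u ^+ N) ^- 2.
Proof.
rewrite /dilog big_add1 /= prodfV; congr (_^-1).
rewrite big_split /= expr2.
(* The values 1 and 3 of k give the offsets 3 and 1 of [dilog]; once a is shifted by one, the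
   exponent is 4a + k. *)
have e k : k%N \in [:: 1; 3]%N ->
    \prod_(0 <= a < N) (1 + q ^+ (4 * a.+1 - (4 - k)) * u) = 1 + u ^+ N.
  move=> k13; have -> : u ^+ N = (q ^+ k * u) ^+ N by rewrite exprMn qX_N mul1r.
  rewrite -(prod_add1_root _ q4_prim).
  apply: eq_bigr => a _; rewrite -exprM mulrA -exprD.
  by congr (1 + q ^+ _ * u); move: k13; rewrite !inE; lia.
by rewrite (e 1%N) // (e 3%N).
Qed.

Definition gauss (t : F) (z : int) : F := q ^ (2 * z ^+ 2) * t ^ z.

Lemma gaussD1 t z : t != 0 -> gauss t (z + 1) = gauss t z * q ^ (4 * z + 2) * t.
Proof.
move=> t0; rewrite /gauss.
have -> : 2 * (z + 1) ^+ 2 = 2 * z ^+ 2 + (4 * z + 2) by ring.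
by rewrite [q ^ _]expfzDr ?q_neq0 // [t ^ _]expfzDr // expr1z; ring.
Qed.

(** Periodicity is what allows the entries to be indexed cyclically: the correction to the exponent
    of q is a multiple of N. *)
Lemma gaussBN t z : t != 0 -> t ^+ N = 1 -> gauss t (z - N%:Z) = gauss t z.
Proof.
move=> t0 tN; rewrite /gauss.
have -> : 2 * (z - N%:Z) ^+ 2 = 2 * z ^+ 2 + N%:Z * (2 * N%:Z - 4 * z) by ring.
rewrite [q ^ _]expfzDr ?q_neq0 // [t ^ _]expfzDr // -exprz_exp.
rewrite -[q ^ N%:Z]/(q ^+ N) (prim_expr_order qprim) exp1rz mulr1.
by rewrite -exprz_inv -[_ ^ N%:Z]/(_ ^+ N) exprVn tN invr1 mulr1.
Qed.

Lemma gauss_neq0 t z : t != 0 -> gauss t z != 0.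
Proof. by move=> t0; rewrite mulf_neq0 ?expfz_neq0 ?q_neq0. Qed.

Lemma ordS_int (j : 'I_N) : exists b : bool, (ordS j)%:Z = j%:Z + 1 - N%:Z *+ b.
Proof.
have [jN|jN] := ltnP j.+1 N.
  by exists false; rewrite /= modn_small //; lia.
have {}jN : j.+1 = N by apply/eqP; rewrite eqn_leq jN ltn_ord.
by exists true; rewrite /= {1}jN modnn; lia.
Qed.

Lemma gauss_ordSr t (j : 'I_N) z : t != 0 -> t ^+ N = 1 ->
  gauss t ((ordS j)%:Z - z) = gauss t (j%:Z + 1 - z).
Proof.
move=> t0 tN; case: (ordS_int j) => -[] ->; last by congr gauss => /=; ring.
by rewrite -[RHS]gaussBN //; congr gauss => /=; ring.
Qed.

Lemma gauss_ordSl t (j : 'I_N) z : t != 0 -> t ^+ N = 1 ->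
  gauss t (z - (ordS j)%:Z) = gauss t (z - 1 - j%:Z).
Proof.
move=> t0 tN; case: (ordS_int j) => -[] ->; last by congr gauss => /=; ring.
by rewrite -[LHS]gaussBN //; congr gauss => /=; ring.
Qed.

(** * The intertwiner for the letter R *)

Lemma mul_1addstd1 c u (M : 'M[F]_N) i j :
  ((1%:M + c *: std1 u) *m M) i j = (1 + c * (u * q ^+ (4 * i))) * M i j.
Proof.
rewrite mulmxDl mul1mx -scalemxAl mxE [X in _ + X]mxE mul_std1; ring.
Qed.

Section LetterR.

Variables u v u' v' : F.
Hypotheses (u0 : u != 0) (v0 : v != 0) (u'0 : u' != 0) (v'0 : v' != 0).
Hypotheses (u1 : 1 + u ^+ N != 0).
Hypothesis u'E : u' ^+ N = (u ^+ N * v ^+ N * (1 + u ^- N) ^+ 2)^-1.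
Hypothesis v'E : v' ^+ N = (1 + u ^+ N) ^+ 2 * v ^+ N.

Let t := u' * v' / (u * 1).
Let h i := (v' / v) ^+ i * dilog u i.

Let C_RE i j : mxC_R N q u v u' v' 1 i j = gauss t (j%:Z - i%:Z) * h i.
Proof. by rewrite mxE /gauss /h !mulrA. Qed.

Let t0 : t != 0.
Proof. by rewrite /t mulr1 !mulf_neq0 ?invr_neq0. Qed.

(** Multiplying the two weight equations gives u'^N v'^N = u^N; hence [gauss t] is N-periodic. *)
Let tN : t ^+ N = 1.
Proof.
rewrite /t mulr1 expr_div_n exprMn u'E v'E; field.
by rewrite !expf_neq0 // addrC u1.
Qed.

Let h_ordS (i : 'I_N) : h (ordS i) =
  h i * (v' / v) / ((1 + q ^+ (4 * i + 1) * u) * (1 + q ^+ (4 * i + 3) * u)).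
Proof.
transitivity (h i.+1); last by rewrite /h exprSr dilogS; ring.
have [iN|iN] := ltnP i.+1 N; first by rewrite /= modn_small.
have {}iN : i.+1 = N by apply/eqP; rewrite eqn_leq iN ltn_ord.
(* At the last index the recursion must return to h 0 = 1: the equation for v'^N says exactly that
   (v'/v)^N cancels [dilog u N]. *)
rewrite /= {1}iN modnn iN /h dilogN expr0 expr_div_n v'E /dilog big_nil; field.
by rewrite u1 expf_neq0.
Qed.

(** This is X_1^-1 C = C X_3' with the inverse moved across. The row factor h is common to both
    sides, so only the step of the Gaussian from j to j + 1 matters. *)
Lemma C_R_std3 :
  mxC_R N q u v u' v' 1 = std1 u *m (mxC_R N q u v u' v' 1 *m std3 u' v').
Proof.
apply/matrixP => i j; rewrite mul_std1 mulmx_std3 !C_RE gauss_ordSr //.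
have -> : j%:Z + 1 - i%:Z = j%:Z - i%:Z + 1 by ring.
rewrite gaussD1 //.
have -> : q ^ (4 * (j%:Z - i%:Z) + 2) = q ^+ (4 * j + 2) / q ^+ (4 * i).
  apply: (canRL (mulfK _)); first by rewrite expf_neq0 ?q_neq0.
  rewrite -[q ^+ (4 * i)]/(q ^ (4 * i)%N%:Z) -expfzDr ?q_neq0 //.
  by rewrite -[RHS]/(q ^ (4 * j + 2)%N%:Z); congr (q ^ _); lia.
rewrite addnC /t; field.
by rewrite u0 u'0 v'0 !expf_neq0 // q_neq0.
Qed.

(** Both shifts move along a diagonal, where the Gaussian is constant; what remains is the recursion
    [h_ordS]. *)
Lemma C_R_std2 :
  (1%:M + q *: std1 u) *m (1%:M + q ^+ 3 *: std1 u) *m std2 v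
    *m mxC_R N q u v u' v' 1 = mxC_R N q u v u' v' 1 *m std2 v'.
Proof.
apply/matrixP => i j'; rewrite -(ord_predK j'); set j := ord_pred j'.
rewrite -!mulmxA !mul_1addstd1 mul_std2 mulmx_std2 !C_RE gauss_ordSr //.
rewrite gauss_ordSl // h_ordS.
have -> : j%:Z + 1 - 1 - i%:Z = j%:Z - i%:Z by ring.
have d k : 1 + q ^+ (4 * i) * q ^+ k * u != 0.
  by rewrite add1_neq0 // -exprD qX_N.
have qD l : q ^+ (4 * i + l) = q ^+ (4 * i) * q ^+ l by rewrite exprD.
rewrite !qD; move: (d 1%N) (d 3%N); move: (q ^+ (4 * i)) => Q.
rewrite !expr1 => d1 d3.
by field; rewrite v0 d1 d3.
Qed.

Lemma C_R_neq0 : mxC_R N q u v u' v' 1 != 0.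
Proof.
have N0 := odd_gt0 Nodd.
apply/eqP => /matrixP/(_ (Ordinal N0) (Ordinal N0))/eqP.
rewrite C_RE mxE /h expr0 /dilog big_nil !mulr1.
by rewrite (negPf (gauss_neq0 _ t0)).
Qed.

End LetterR.

(** * The intertwiner for the letter L *)

Lemma mul_1addstd2 c v (M : 'M[F]_N) i j :
  ((1%:M + c *: std2 v) *m M) i j = M i j + c * v * M (ordS i) j.
Proof.
rewrite mulmxDl mul1mx -scalemxAl mxE [X in _ + X]mxE mul_std2; ring.
Qed.

Lemma sum_nat_shift (f : nat -> F) :
  f 0 = f N -> \sum_(0 <= k < N) f k = \sum_(1 <= k < N.+1) f k.
Proof.
case: (N) => [_|n f0]; first by rewrite !big_geq.
rewrite big_nat_recl // [RHS]big_nat_recr //= addrC f0; congr (_ + _).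
by rewrite big_add1.
Qed.

Section LetterL.

Variables u v u' v' : F.
Hypotheses (u0 : u != 0) (v0 : v != 0) (u'0 : u' != 0) (v'0 : v' != 0).
Hypotheses (v1 : 1 + v ^+ N != 0).
Hypothesis u'E : u' ^+ N = u ^+ N / (1 + v ^- N) ^+ 2.
Hypothesis v'E : v' ^+ N = (1 + v ^+ N) ^+ 2 / (u ^+ N * v ^+ N).

Let t := u' * v' / (v * 1).
Let s := u * v * v' / 1.
Let d k := q ^ (2 * k%:Z ^+ 2) * s ^+ k * dilog v k.

(** The entries are a discrete Fourier transform in the row index. On the mode q^(4ik) the shift
    [std2 v] acts by v q^(4k), so k plays the part that the row index has for the letter R. *)
Let C_LE (i j : 'I_N) : mxC_L N q u v u' v' 1 i j =
  \sum_(1 <= k < N.+1) q ^+ (4 * i * k) * (gauss t (j%:Z - k%:Z) * d k).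
Proof.
rewrite mxE; apply: eq_bigr => k _; rewrite /gauss /d.
by rewrite [q ^ (_ + _)]expfzDr ?q_neq0 // /dilog -/t -/s; ring.
Qed.

Let t0 : t != 0.
Proof. by rewrite /t mulr1 !mulf_neq0 ?invr_neq0. Qed.

Let tN : t ^+ N = 1.
Proof.
rewrite /t mulr1 expr_div_n exprMn u'E v'E; field.
by rewrite !expf_neq0 // addrC v1.
Qed.

Let dS k : d k.+1 = d k * q ^+ (4 * k + 2) * s /
  ((1 + q ^+ (4 * k + 1) * v) * (1 + q ^+ (4 * k + 3) * v)).
Proof.
rewrite /d dilogS [s ^+ _.+1]exprS.
have -> : q ^ (2 * k.+1%:Z ^+ 2) = q ^ (2 * k%:Z ^+ 2) * q ^+ (4 * k + 2).
  rewrite -[q ^+ (4 * k + 2)]/(q ^ (4 * k + 2)%N%:Z) -expfzDr ?q_neq0 //.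
  by congr (q ^ _); lia.
ring.
Qed.

(** The equation for v'^N makes s^N cancel [dilog v N], so that the sum over modes may start at 0 or
    at 1. *)
Let dN : d N = d 0.
Proof.
have -> : d 0 = 1 by rewrite /d /dilog big_nil expr0 !mulr1.
rewrite /d dilogN /s divr1 !exprMn v'E.
have -> : q ^ (2 * N%:Z ^+ 2) = 1.
  rewrite (_ : 2 * N%:Z ^+ 2 = N%:Z * (2 * N%:Z)); last by ring.
  by rewrite -exprz_exp -[q ^ N%:Z]/(q ^+ N) (prim_expr_order qprim) exp1rz.
by field; rewrite v1 !expf_neq0.
Qed.

Lemma C_L_std3 :
  mxC_L N q u v u' v' 1 = std2 v *m (mxC_L N q u v u' v' 1 *m std3 u' v').
Proof.
apply/matrixP => i j; rewrite mul_std2 mulmx_std3 !C_LE mulr_suml mulr_sumr.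
apply: eq_bigr => k _; rewrite gauss_ordSr //.
have -> : j%:Z + 1 - k%:Z = j%:Z - k%:Z + 1 by ring.
rewrite gaussD1 // [in RHS]exprM q4_ordS exprMn -!exprM.
have -> : q ^ (4 * (j%:Z - k%:Z) + 2) = q ^+ (4 * j + 2) / q ^+ (4 * k).
  apply: (canRL (mulfK _)); first by rewrite expf_neq0 ?q_neq0.
  rewrite -[q ^+ (4 * k)]/(q ^ (4 * k)%N%:Z) -expfzDr ?q_neq0 //.
  by rewrite -[RHS]/(q ^ (4 * j + 2)%N%:Z); congr (q ^ _); lia.
rewrite (addnC 2%N) /t.
have Q0 n : q ^+ n != 0 by rewrite expf_neq0 ?q_neq0.
move: (Q0 (4 * k)%N) (Q0 (4 * j + 2)%N).
move: (q ^+ (4 * k)) (q ^+ (4 * j + 2)) (q ^+ (4 * i * k)) => a b c a0 b0.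
by field; rewrite v0 u'0 v'0 a0 b0.
Qed.

Lemma C_L_std2 :
  (1%:M + q *: std2 v) *m (1%:M + q ^+ 3 *: std2 v) *m std3 u v
    *m mxC_L N q u v u' v' 1 = mxC_L N q u v u' v' 1 *m std2 v'.
Proof.
pose E (j : 'I_N) k := gauss t (j%:Z - k%:Z) * d k.
(* [std3 u v] multiplies row i by q^(-4i) up to a constant while shifting it, which lowers the mode
   by one: the sum over 1..N becomes one over 0..N-1. *)
have std3C i j : (std3 u v *m mxC_L N q u v u' v' 1) i j =
    \sum_(0 <= k < N) q ^+ (4 * i * k) * (E j k.+1 / (q ^+ (4 * k + 2) * u * v)).
  rewrite -(ord_predK i) mul_std3 C_LE mulr_sumr big_add1 /=.
  apply: eq_bigr => k _; rewrite -/(E j k.+1).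
  have -> : q ^+ (4 * ordS (ord_pred i) * k) =
      q ^+ (4 * ord_pred i * k) * q ^+ (4 * k).
    by rewrite exprM q4_ordS exprMn -!exprM.
  have -> : q ^+ (4 * ord_pred i * k.+1) =
      q ^+ (4 * ord_pred i) * q ^+ (4 * ord_pred i * k) by rewrite mulnS exprD.
  have -> : q ^+ (2 + 4 * ord_pred i) = q ^+ 2 * q ^+ (4 * ord_pred i).
    by rewrite exprD.
  have -> : q ^+ (4 * k + 2) = q ^+ (4 * k) * q ^+ 2 by rewrite exprD.
  have Q0 n : q ^+ n != 0 by rewrite expf_neq0 ?q_neq0.
  move: (Q0 (4 * k)%N) (Q0 (4 * ord_pred i)%N) (Q0 2%N).
  move: (q ^+ (4 * k)) (q ^+ (4 * ord_pred i)) (q ^+ (4 * ord_pred i * k)).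
  by move=> a b c a0 b0 c0; field; rewrite u0 v0 a0 b0 q_neq0.
apply/matrixP => i j'; rewrite -(ord_predK j'); set j := ord_pred j'.
rewrite -!mulmxA mulmx_std2 !mul_1addstd2 !std3C C_LE.
(* On mode k the two factors act by 1 + q^(4k+1) v and 1 + q^(4k+3) v, the denominators in the
   recursion [dS]; the identity therefore holds term by term. *)
transitivity (\sum_(0 <= k < N) q ^+ (4 * i * k) * (E j k * v')).
  rewrite !mulr_sumr -!big_split /= mulr_sumr -big_split /=.
  apply: eq_bigr => k _.
  have qS (l : 'I_N) : q ^+ (4 * ordS l * k) = q ^+ (4 * l * k) * q ^+ (4 * k).
    by rewrite exprM q4_ordS exprMn -!exprM.
  rewrite (qS (ordS i)) !qS /E dS.
  have -> : (gauss t ((ordS j)%:Z - k.+1%:Z)) = gauss t (j%:Z - k%:Z).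
    by rewrite gauss_ordSr //; congr gauss; lia.
  have dk l : 1 + q ^+ (4 * k) * q ^+ l * v != 0.
    by rewrite add1_neq0 // -exprD qX_N.
  have qD l : q ^+ (4 * k + l) = q ^+ (4 * k) * q ^+ l by rewrite exprD.
  move: (dk 1%N) (dk 3%N).
  rewrite !qD !expr1 /s divr1 => d1 d3.
  have Q0 n : q ^+ n != 0 by rewrite expf_neq0 ?q_neq0.
  move: (Q0 (4 * k)%N) d1 d3; move: (q ^+ (4 * k)) (q ^+ (4 * i * k)).
  move=> Q b Q0' d1 d3.
  by field; rewrite u0 v0 d1 d3 Q0' q_neq0.
rewrite sum_nat_shift; last first.
  rewrite /E dN -(gaussBN _ t0 tN) subr0; congr (_ * _).
  by rewrite muln0 expr0 exprM qX_N.
by rewrite mulr_suml; apply: eq_bigr => k _; rewrite /E mulrA.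
Qed.

(** Summing the first column over all rows keeps only the constant mode k = N, with coefficient N
    times a nonzero Gaussian. *)
Lemma C_L_neq0 : mxC_L N q u v u' v' 1 != 0.
Proof.
have N0 := odd_gt0 Nodd.
pose j := Ordinal N0.
have sumC : \sum_(i < N) mxC_L N q u v u' v' 1 i j =
    N%:R * (gauss t (j%:Z - N%:Z) * d N).
  under eq_bigr do rewrite C_LE.
  rewrite exchange_big /= big_nat_recr //= big_nat_cond big1 ?add0r.
    transitivity (\sum_(i < N) (gauss t (- N%:Z) * d N)).
      by apply: eq_bigr => i _; rewrite exprM qX_N mul1r.
    by rewrite sumr_const card_ord mulr_natl.
  move=> k; rewrite andbT => /andP[k0 kN]; rewrite -mulr_suml.
  under eq_bigr do rewrite mulnAC exprM.
  rewrite sum_expr_root_neq1 ?mul0r ?qX_N //.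
  rewrite exprM -(prim_order_dvd q4_prim) /dvdn modn_small // -lt0n //.
apply: contraTneq (prim_root_natf_neq0 qprim) => C0.
have := sumC; rewrite C0 big1 => [/esym/eqP|i _]; last by rewrite mxE.
rewrite mulf_eq0 [X in _ || X]mulf_eq0 (negPf (gauss_neq0 _ t0)) dN.
rewrite /d /dilog big_nil expr0 !mulr1.
by rewrite oner_eq0 orbF orbF negbK.
Qed.

End LetterL.

(** * Relations and invertibility under a coordinate change *)

Lemma std_scale_ordS u v (i : 'I_N) :
  (q ^+ (2 + 4 * ordS i) * u * v)^-1 = q ^- 4 * (q ^+ (2 + 4 * i) * u * v)^-1.
Proof.
have qD l : q ^+ (2 + 4 * l) = q ^+ 2 * q ^+ (4 * l) by rewrite exprD.
by rewrite !qD q4_ordS -invfM; congr (_^-1); ring.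
Qed.

Lemma std23 u v : std2 v *m std3 u v = q ^- 4 *: (std3 u v *m std2 v).
Proof.
apply/matrixP => i' j; rewrite -(ord_predK i'); set i := ord_pred i'.
rewrite mulmx_std3 [RHS]mxE mul_std3 !mxE (inj_eq (@ordS_inj N)).
case: eqP => [->|_]; last by rewrite !mulr0 mul0r.
by rewrite std_scale_ordS; ring.
Qed.

Lemma std31 u v : std3 u v *m std1 u = q ^- 4 *: (std1 u *m std3 u v).
Proof.
apply/matrixP => i j; rewrite mulmx_std1 [RHS]mxE mul_std1 !mxE.
case: eqP => [->|_]; last by rewrite !(mulr0, mul0r).
rewrite q4_ordS; move: (_ * u * v)^-1 => c.
by field; rewrite q_neq0.
Qed.

(** A singular matrix would give a left eigenvector of M for -1/c, whose N-th power is -1, forcing m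
    = -1. *)
Lemma unit_1addmx c m (M : 'M[F]_N) :
  c ^+ N = 1 -> 1 + m != 0 -> M ^+ N = m%:M -> 1%:M + c *: M \in unitmx.
Proof.
move=> cN m1 MN; have c0 := expr_eq1_neq0 cN.
apply: contraNT m1; rewrite unitmxE unitfE negbK => /det0P[z z0].
rewrite mulmxDr mulmx1 -scalemxAr => /eqP; rewrite addrC addr_eq0 => /eqP zM.
have zX k : z *m M ^+ k = (- c^-1) ^+ k *: z.
  elim: k => [|k IHk]; first by rewrite mulmx1 scale1r.
  rewrite exprSr [_ * _]/(_ *m _) mulmxA IHk -scalemxAl exprSr -scalerA.
  by congr (_ *: _); rewrite scaleNr -scalerN -zM scalerA mulVf // scale1r.
have := zX N; rewrite MN mul_mx_scalar exprNn -signr_odd Nodd exprVn cN invr1.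
rewrite mulr1 expr1 => /eqP; rewrite -subr_eq0 -scalerBl scaler_eq0 (negPf z0).
by rewrite orbF opprK addrC.
Qed.

(** The coordinate change preserves H = 1, the new counterclockwise order being b, a, e'. Moving B
    to the right divides the coefficients of E by q^4, after which the polynomial factors cancel the
    inverses up to E^2. *)
Lemma exchange_H (E A B : 'M[F]_N) (Y := invmx E) :
    E \in unitmx -> 1%:M + q *: Y \in unitmx -> 1%:M + q ^+ 3 *: Y \in unitmx ->
    A *m B = q ^- 4 *: (B *m A) -> B *m E = q ^- 4 *: (E *m B) ->
    q ^+ 2 *: (E *m A *m B) = 1%:M ->
  q ^+ 2 *: (invmx (1%:M + q *: Y) *m invmx (1%:M + q ^+ 3 *: Y) *m B
    *m ((1%:M + q *: E) *m (1%:M + q ^+ 3 *: E) *m A) *m Y) = 1%:M.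
Proof.
move=> Eu u1 u3 AB BE H; have q0 := q_neq0.
have Q0 n : q ^+ n != 0 by rewrite expf_neq0.
set k1 := 1%:M + q *: Y in u1 *; set k3 := 1%:M + q ^+ 3 *: Y in u3 *.
have Bcomm c : B *m (1%:M + c *: E) = (1%:M + (c / q ^+ 4) *: E) *m B.
  by rewrite mulmxDr mulmxDl mulmx1 mul1mx -scalemxAr BE scalerA -scalemxAl.
have kE c : (1%:M + c *: Y) *m E = E + c%:M.
  by rewrite mulmxDl mul1mx -scalemxAl mulVmx // scalemx1.
have BA : B *m A = q ^+ 4 *: (A *m B) by rewrite AB scalerA divff // scale1r.
have facE c : c != 0 -> 1%:M + c *: E = c *: (E + (c^-1)%:M).
  by move=> c0; rewrite scalerDr scale_scalar_mx divff // addrC.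
have e1 : (q / q ^+ 4)^-1 = q ^+ 3.
  by field; rewrite q0 oner_eq0.
have e3 : (q ^+ 3 / q ^+ 4)^-1 = q.
  by field; rewrite q0 oner_eq0.
have k13 : (1%:M + (q / q ^+ 4) *: E) *m (1%:M + (q ^+ 3 / q ^+ 4) *: E) =
    q ^- 4 *: (k3 *m k1 *m E *m E).
  rewrite !facE ?mulf_neq0 ?invr_neq0 // -scalemxAl -scalemxAr scalerA.
  rewrite -[k3 *m k1 *m E]mulmxA kE -[k3 *m _ *m E]mulmxA.
  have -> : (E + q%:M) *m E = E *m (E + q%:M).
    by rewrite mulmxDl mulmxDr mul_scalar_mx mul_mx_scalar.
  rewrite mulmxA kE.
  congr (_ *: _); first by field.
  by rewrite e1 e3.
rewrite !mulmxA -[_ *m B *m _]mulmxA Bcomm mulmxA.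
rewrite -[_ *m B *m _]mulmxA Bcomm !mulmxA.
rewrite -[_ *m (1%:M + (q / _) *: E) *m _]mulmxA k13 -!scalemxAr -!scalemxAl.
rewrite !mulmxA mulmxKV // mulVmx // mul1mx.
rewrite -[_ *m B *m A]mulmxA BA -scalemxAr -!scalemxAl !scalerA mulmxA.
rewrite -[E *m E *m A]mulmxA -[E *m _ *m B]mulmxA.
have -> : E *m A *m B = (q ^- 2)%:M.
  by rewrite -[LHS]scale1r -(mulVf (Q0 2%N)) -scalerA H scalemx1.
rewrite mul_mx_scalar -scalemxAl mulmxV // scalerA scalemx1.
by congr (_%:M); field.
Qed.

(** H = 1 makes B the inverse of q^2 A E, and B' that of q^2 A' E'. *)
Lemma third_intertwiner (E A B E' A' B' C : 'M[F]_N) :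
    q ^+ 2 *: (B *m A *m E) = 1%:M -> q ^+ 2 *: (B' *m A' *m E') = 1%:M ->
    E *m C = C *m E' -> A *m C = C *m A' ->
  B *m C = C *m B'.
Proof.
move=> H H' EC AC; have := H'; rewrite -mulmxA scalemxAl => /mulmx1C H''.
have BCAE : q ^+ 2 *: (B *m C *m A' *m E') = C.
  rewrite -[B *m C *m A']mulmxA -AC mulmxA -[_ *m E']mulmxA -EC mulmxA.
  by rewrite scalemxAl H mul1mx.
rewrite -[LHS]mulmx1 -H'' -scalemxAr -scalemxAr !mulmxA scalemxAl.
by rewrite BCAE.
Qed.

(* The edges in the counterclockwise order [e, a, b] starting from the edge [e]
   which the letter exchanges: slope [0] for [R], slope [oo] for [L]. *)
Definition exchanged (T : Type) (a : letter) (X1 X2 X3 : T) : T * T * T :=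
  match a with LetterR => (X1, X2, X3) | LetterL => (X2, X3, X1) end.

Definition weights_step (a : letter) (u v u' v' : F) : Prop :=
  match a with
  | LetterR => u' ^+ N = (u ^+ N * v ^+ N * (1 + u ^- N) ^+ 2)^-1 /\
               v' ^+ N = (1 + u ^+ N) ^+ 2 * v ^+ N
  | LetterL => u' ^+ N = u ^+ N / (1 + v ^- N) ^+ 2 /\
               v' ^+ N = (1 + v ^+ N) ^+ 2 / (u ^+ N * v ^+ N)
  end.

Lemma letter_intertwiner (a : letter) u v u' v'
    (C := mxC_letter N q a u v u' v' 1) :
    u != 0 -> v != 0 -> u' != 0 -> v' != 0 -> weights_step a u v u' v' ->
  C \in unitmx /\
  let: (E, A, B) := exchanged a (std1 u) (std2 v) (std3 u v) in
  let Y := invmx E in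
  [/\ [/\ 1%:M + q *: E \in unitmx, 1%:M + q ^+ 3 *: E \in unitmx,
          1%:M + q *: Y \in unitmx & 1%:M + q ^+ 3 *: Y \in unitmx],
      Y *m C = C *m std3 u' v',
      (1%:M + q *: E) *m (1%:M + q ^+ 3 *: E) *m A *m C = C *m std2 v' &
      invmx (1%:M + q *: Y) *m invmx (1%:M + q ^+ 3 *: Y) *m B *m C
        = C *m std1 u'].
Proof.
move=> u0 v0 u'0 v'0 Huv.
have qN : q ^+ N = 1 := prim_expr_order qprim.
pose x := match a with LetterR => u ^+ N | LetterL => v ^+ N end.
(* The formula for v'^N contains the factor (1 + x)^2, and v' is nonzero. *)
have x1 : 1 + x != 0.
  have : v' ^+ N != 0 by rewrite expf_neq0.
  rewrite /x; case: a Huv {C x} => -[_ ->]; apply: contra_neq => ->.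
    by rewrite expr2 !mul0r.
  by rewrite expr2 !mul0r.
have C0 : C != 0.
  rewrite /C /x in Huv x1 *; case: a Huv x1 {C x} => -[u'E v'E] x1.
    exact: C_R_neq0.
  exact: C_L_neq0.
case eEAB : (exchanged _ _ _ _) => [[E A] B] /=.
have [EA AB BE] : [/\ E *m A = q ^- 4 *: (A *m E),
    A *m B = q ^- 4 *: (B *m A) & B *m E = q ^- 4 *: (E *m B)].
  move: eEAB; case: (a) => -[<- <- <-];
    by split; rewrite ?std12 ?std23 ?std31.
have H : q ^+ 2 *: (E *m A *m B) = 1%:M.
  have H := std_H u0 v0.
  move: eEAB; case: (a) => -[<- <- <-] //.
  by rewrite scalemxAl; apply: mulmx1C; rewrite -scalemxAr mulmxA.
have EN : E ^+ N = x%:M.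
  by move: eEAB; rewrite /x; case: (a) => -[<- _ _]; rewrite ?std1N ?std2N.
have Eu : E \in unitmx.
  by move: H; rewrite -mulmxA scalemxAr => /mulmx1_unit[].
have units c : c ^+ N = 1 -> 1%:M + c *: E \in unitmx.
  by move=> cN; exact: unit_1addmx cN x1 EN.
have unitsV c : c ^+ N = 1 -> 1%:M + c *: invmx E \in unitmx.
  move=> cN; have c0 := expr_eq1_neq0 cN.
  (* Factoring out c E^-1 reduces the claim to 1 + c^-1 E, where c^-1 is again an N-th root of
     unity. *)
  rewrite (_ : _ + _ = c *: (invmx E *m (1%:M + c^-1 *: E))).
    rewrite unitmxZ ?unitfE // unitmx_mul unitmx_inv Eu units //.
    by rewrite exprVn cN invr1.
  rewrite mulmxDr mulmx1 -scalemxAr mulVmx // scalerDr scalerA divff //.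
  by rewrite scale1r addrC.
have CE : C = E *m (C *m std3 u' v').
  rewrite /C /x in Huv x1 *.
  move: eEAB Huv x1; case: (a) => -[<- _ _] -[u'E v'E] x1.
    exact: C_R_std3.
  exact: C_L_std3.
have YC : invmx E *m C = C *m std3 u' v' by rewrite {1}CE mulKmx.
have AC : (1%:M + q *: E) *m (1%:M + q ^+ 3 *: E) *m A *m C = C *m std2 v'.
  rewrite /C /x in Huv x1 *.
  move: eEAB Huv x1; case: (a) => -[<- <- _] -[u'E v'E] x1.
    exact: C_R_std2.
  exact: C_L_std2.
have BC : invmx (1%:M + q *: invmx E) *m invmx (1%:M + q ^+ 3 *: invmx E) *m B
    *m C = C *m std1 u'.
  apply: third_intertwiner YC AC; last exact: std_H.
  by apply: exchange_H => //; apply: unitsV; rewrite // qX_N.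
split; last by split=> //; split; rewrite ?units ?unitsV ?qX_N.
exact: (std_intertwiner u'0 v'0 C0 (esym BC) (esym AC)).
Qed.

(** Schur's lemma made explicit: commuting with a diagonal matrix of distinct entries forces M to be
    diagonal, and the cyclic shift makes its entries equal. *)
Lemma std_commutant u v (M : 'M[F]_N) : u != 0 -> v != 0 ->
  M *m std1 u = std1 u *m M -> M *m std2 v = std2 v *m M ->
  exists c, M = c%:M.
Proof.
move=> u0 v0 M1 M2.
have Mdiag i j : i != j -> M i j = 0.
  move=> ij; have /matrixP/(_ i j) := M1; rewrite mulmx_std1 mul_std1 => /eqP.
  rewrite mulrC -subr_eq0 -mulrBl mulf_eq0 => /orP[|/eqP //].
  rewrite -mulrBr mulf_eq0 (negPf u0) /= subr_eq0 => /eqP qij.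
  by case/eqP: ij; apply: q4X_inj; rewrite -qij divff // expf_neq0 // q_neq0.
have Mstep i j : M (ordS i) (ordS j) = M i j.
  apply: (mulfI v0); have /matrixP/(_ i (ordS j)) := M2.
  by rewrite mulmx_std2 mul_std2 => <-; rewrite mulrC.
have Miter k i : M (iter k (@ordS N) i) (iter k (@ordS N) i) = M i i.
  by elim: k => //= k IHk; rewrite Mstep.
have N0 := odd_gt0 Nodd.
exists (M (Ordinal N0) (Ordinal N0)); apply/matrixP => i j; rewrite !mxE.
have [<-|/Mdiag //] := eqVneq i j; rewrite mulr1n -(Miter i (Ordinal N0)).
by congr (M _ _); apply: val_inj; rewrite /= iter_ordS add0n modn_small.
Qed.

(** An eigenvector of X_1 for u, moved around by the powers of X_2, gives the standard basis. *)
Lemma std_model u v (X1 X2 : 'M[F]_N) : u != 0 -> v != 0 ->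
    X1 *m X2 = q ^- 4 *: (X2 *m X1) ->
    X1 ^+ N = (u ^+ N)%:M -> X2 ^+ N = (v ^+ N)%:M ->
  exists Q, [/\ Q \in unitmx, X1 *m Q = Q *m std1 u & X2 *m Q = Q *m std2 v].
Proof.
move=> u0 v0 X12 X1N X2N; have N0 := odd_gt0 Nodd.
have Q0 n : q ^+ n != 0 by rewrite expf_neq0 // q_neq0.
have X12X k : X1 *m X2 ^+ k = q ^- (4 * k) *: (X2 ^+ k *m X1).
  elim: k => [|k IHk]; first by rewrite muln0 invr1 scale1r mulmx1 mul1mx.
  rewrite exprS -[_ * _]/(X2 *m _) mulmxA X12 -scalemxAl -mulmxA IHk -scalemxAr.
  by rewrite scalerA -invfM -exprD -mulnS mulmxA.
have scaleX (c : F) k : (c *: X1) ^+ k = c ^+ k *: X1 ^+ k.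
  elim: k => [|k IHk]; first by rewrite !expr0 scale1r.
  rewrite !exprS IHk -[LHS]/((c *: X1) *m (c ^+ k *: X1 ^+ k)).
  by rewrite -scalemxAl -scalemxAr scalerA.
pose z m := u * q ^+ (4 * m).
have z0 m : z m != 0 by rewrite mulf_neq0.
have zN m : z m ^+ N = u ^+ N by rewrite exprMn qX_N mulr1.
(* N times the projector onto the eigenspace of X_1 for z m; these sum to N, so one of them is
   nonzero. *)
pose P m := \sum_(k < N) ((z m)^-1 *: X1) ^+ k.
have X1P m : X1 *m P m = z m *: P m.
  have := subrX1 ((z m)^-1 *: X1) N.
  rewrite scaleX X1N exprVn zN scale_scalar_mx mulVf ?expf_neq0 // subrr.
  rewrite -/(P m) mulrBl mul1r => /esym/eqP; rewrite subr_eq0 => /eqP {2}<-.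
  by rewrite -[_ * _]scalemxAl scalerA divff // scale1r.
have sumP : \sum_(m < N) P m = N%:R%:M.
  rewrite exchange_big /= (bigD1 (Ordinal N0)) //=.
  rewrite [X in _ + X]big1 ?addr0 => [|k k0].
    by rewrite sumr_const card_ord -scaler_nat scalemx1.
  have zX m : (z m)^-1 ^+ k = u ^- k * q ^- (4 * k) ^+ m.
    by rewrite /z !exprVn exprMn invfM -!exprM mulnAC.
  under eq_bigr do rewrite scaleX zX.
  rewrite -scaler_suml -mulr_sumr sum_expr_root_neq1 ?mulr0 ?scale0r //.
    by rewrite exprVn qX_N invr1.
  rewrite invr_eq1 exprM -(prim_order_dvd q4_prim) /dvdn modn_small //.
have [m [a [b Pm]]] : exists m : 'I_N, exists a, exists b, P m a b != 0.
  pose o := Ordinal N0; suff: [exists m : 'I_N, P m o o != 0].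
    by move/existsP => [m Pm]; exists m, o, o.
  apply: contraT; rewrite negb_exists => /forallP P0.
  have /matrixP/(_ o o)/eqP := sumP; rewrite summxE big1 => [|m _].
    by rewrite mxE eqxx eq_sym (negPf (prim_root_natf_neq0 qprim)).
  by apply/eqP; rewrite -[_ == _]negbK.
(* X_2^m brings the eigenvalue u q^(4m) back to u. *)
pose w := X2 ^+ m *m col b (P m).
have X1w : X1 *m w = u *: w.
  rewrite /w mulmxA X12X -scalemxAl -mulmxA colE (mulmxA X1) X1P.
  rewrite -scalemxAl -scalemxAr scalerA; congr (_ *: _).
  by rewrite /z mulrCA mulVf ?mulr1.
have X2X k : X2 ^+ (N + k) = v ^+ N *: X2 ^+ k.
  by rewrite exprD X2N [LHS]mul_scalar_mx.
have X2u : X2 ^+ m \in unitmx.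
  have: X2 ^+ m *m (v ^- N *: X2 ^+ (N - m)) = 1%:M.
    rewrite -scalemxAr -[_ *m _]exprD subnKC 1?ltnW // X2N scale_scalar_mx.
    by rewrite mulVf // expf_neq0.
  by case/mulmx1_unit.
have w0 : w != 0.
  apply: contraNneq Pm => /(congr1 (mulmx (invmx (X2 ^+ m)))).
  by rewrite mulmx0 mulKmx // => /colP/(_ a); rewrite !mxE => ->.
(* Column j is (X_2 / v)^(-j) w, with the exponent N - j in place of -j since X_2^N = v^N. *)
pose Q := \matrix_(i < N, j < N) (v ^- (N - j) *: (X2 ^+ (N - j) *m w)) i 0.
have colQ j : col j Q = v ^- (N - j) *: (X2 ^+ (N - j) *m w).
  by apply/colP => i; rewrite !mxE.
have scaleE c (A : 'cV[F]_N) i : (c *: A) i 0 = c * A i 0 by rewrite mxE.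
have X1Q : X1 *m Q = Q *m std1 u.
  apply/matrixP => i j; rewrite mulmx_std1.
  transitivity ((X1 *m col j Q) i 0); first by rewrite colE mulmxA -colE [RHS]mxE.
  have -> : Q i j = (col j Q) i 0 by rewrite [RHS]mxE.
  rewrite colQ -scalemxAr mulmxA X12X -scalemxAl -mulmxA X1w -scalemxAr.
  have -> : q ^- (4 * (N - j)) = q ^+ (4 * j).
    apply: (mulfI (Q0 (4 * (N - j))%N)).
    by rewrite divff // -exprD -mulnDr subnK 1?ltnW // exprM qX_N.
  by rewrite !scaleE; ring.
have X2Q : X2 *m Q = Q *m std2 v.
  apply/matrixP => i j'; rewrite -(ord_predK j'); set j := ord_pred j'.
  rewrite mulmx_std2.
  transitivity ((X2 *m col (ordS j) Q) i 0).
    by rewrite colE mulmxA -colE [RHS]mxE.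
  have -> : Q i j = (col j Q) i 0 by rewrite [RHS]mxE.
  rewrite !colQ -scalemxAr !scaleE mulmxA -[X2 *m _]exprS.
  have [jN|jN] := ltnP j.+1 N.
    rewrite /= modn_small // -[(N - j)%N]subnSK //.
    move: (N - j.+1)%N (X2 ^+ _ *m w) => k y.
    rewrite exprSr invfM -!mulrA; congr (_ * _).
    by rewrite mulrCA mulVf // mulr1.
  have {}jN : j.+1 = N by apply/eqP; rewrite eqn_leq jN ltn_ord.
  have -> : (ordS j = 0 :> nat) by rewrite /= {1}jN modnn.
  have -> : (N - j = 1)%N by rewrite -{1}jN subSnn.
  rewrite subn0 -[N.+1]addn1 X2X expr1 -scalemxAl scaleE expr1; field.
  by rewrite expf_neq0 v0.
exists Q; split=> //; apply: (std_intertwiner u0 v0 _ (esym X1Q) (esym X2Q)).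
apply: contraNneq w0 => Q0'; apply/eqP.
have := colQ (Ordinal N0); rewrite Q0' col0 subn0 X2N mul_scalar_mx scalerA.
by rewrite mulVf ?expf_neq0 // scale1r.
Qed.

End StandardRepresentation.

(** * Diagonal exchanges and the Farey tree *)

Definition cross (v w : 'cV[int]_2) : int := v 0 0 * w 1 0 - v 1 0 * w 0 0.

Lemma crossC v w : cross w v = - cross v w.
Proof. by rewrite /cross; ring. Qed.

Lemma crossNl v w : cross (- v) w = - cross v w.
Proof. by rewrite /cross !mxE; ring. Qed.

Lemma crossNr v w : cross v (- w) = - cross v w.
Proof. by rewrite /cross !mxE; ring. Qed.

(** Coprimality of the coordinates in Bezout form, as the area condition of [side_vectors] provides
    it. *)
Definition primitive_vector (v : 'cV[int]_2) : Prop :=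
  exists w, cross v w = 1.

Lemma cV2P (T : Type) (v w : 'cV[T]_2) :
  v 0 0 = w 0 0 -> v 1 0 = w 1 0 -> v = w.
Proof.
move=> v0 v1; apply/colP => i.
have [->|->] : i = 0 \/ i = 1.
  by case: i => -[|[|//]] h; [left|right]; exact: val_inj.
  exact: v0.
exact: v1.
Qed.

Lemma slope_ofN v : slope_of (- v) = slope_of v.
Proof. by rewrite /slope_of !mxE oppr_eq0 !intrN invrN mulrNN. Qed.

Lemma slope_of_cross v w : slope_of v = slope_of w -> cross v w = 0.
Proof.
rewrite /slope_of /cross; case: eqP => [->|/eqP v0]; case: eqP => [->|/eqP w0] //.
  by rewrite mul0r mulr0 subrr.
move=> [] /eqP; rewrite eqr_div ?intr_eq0 // -!intrM eqr_int => /eqP.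
by move=> e; apply/eqP; rewrite subr_eq0 e mulrC.
Qed.

(** Collinear primitive vectors are integer multiples of each other, and the two integers have
    product 1. *)
Lemma slope_of_inj v w : primitive_vector v -> primitive_vector w ->
  slope_of v = slope_of w -> w = v \/ w = - v.
Proof.
move=> [v' vv'] [w' ww'] /slope_of_cross vw.
have colin (x y x' : 'cV[int]_2) : cross x x' = 1 -> cross x y = 0 ->
    y = cross y x' *: x.
  move=> xx' xy; apply: cV2P; rewrite mxE -[LHS]mulr1 -xx'.
    rewrite -[RHS]addr0 -(mulr0 (x' 0 0)) -xy /cross; ring.
  rewrite -[RHS]addr0 -(mulr0 (x' 1 0)) -xy /cross; ring.
have wE := colin _ _ _ vv' vw.
have vE : v = cross v w' *: w.
  by apply: (colin _ _ _ ww'); rewrite crossC vw oppr0.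
have: cross w v' * cross v w' = 1.
  rewrite -vv' [in RHS]vE /cross !mxE; ring.
rewrite mulrC => /intUnitRing.unitzPl; rewrite qualifE => /orP[] /eqP c1.
  by left; rewrite wE c1 scale1r.
by right; rewrite wE c1 scaleN1r.
Qed.

Lemma slope_vector_primitive s : primitive_vector (slope_vector s).
Proof.
case: s => [r|]; last first.
  by exists (\col_i (if i == 0 then -1 else 0)); rewrite /cross !mxE.
have /coprimezP[[a b] /= ab] : coprimez (numq r) (denq r).
  rewrite /coprimez /gcdz; have := coprime_num_den r.
  by rewrite /coprime => /eqP ->.
exists (\col_i (if i == 0 then - a else b)); rewrite /cross !mxE /=; lia.
Qed.

Lemma slope_vectorK s : slope_of (slope_vector s) = s.
Proof.
case: s => [r|]; rewrite /slope_of !mxE //=.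
by rewrite (negPf (denq_neq0 r)) divq_num_den.
Qed.

(* The heights of the edges of slopes [0], [oo], [1] are all [1]: for this
   quadratic form, [lambda0] is the root of the Farey tree. *)
Definition norm_vector (v : 'cV[int]_2) : int :=
  v 0 0 ^+ 2 - v 0 0 * v 1 0 + v 1 0 ^+ 2.

Definition height (s : slope) : int := norm_vector (slope_vector s).

Lemma norm_vector_ge0 v : 0 <= norm_vector v.
Proof. by rewrite /norm_vector; nia. Qed.

Lemma height_slope_of v : primitive_vector v ->
  height (slope_of v) = norm_vector v.
Proof.
move=> vp; have := slope_of_inj (slope_vector_primitive _) vp (slope_vectorK _).
rewrite /height; move: (slope_vector _) => s [->|->] //.
by rewrite /norm_vector !mxE; ring.
Qed.

Lemma cross_primitive v w : cross v w = 1 ->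
  [/\ primitive_vector v, primitive_vector w & primitive_vector (v + w)].
Proof.
move=> vw; split; [exists w | exists (- v) | exists w] => //;
  by rewrite -vw /cross !mxE; ring.
Qed.

(** The edges a and b determine w and v + w up to sign. The old diagonal is the difference of these
    vectors, and orientation forces the new one to be their sum. *)
Lemma diagonal_exchangeP e a b e' : diagonal_exchange e a b e' ->
  exists v w, side_vectors (e, a, b) v w /\ e' = slope_of (v + w + w).
Proof.
move=> [[v [w vw]] [v' [w' [/= ve' wb va vw']]]]; exists v, w; split=> //.
case: vw => /= _ wa vb vw.
have [_ wp vwp] := cross_primitive vw; have [_ w'p vw'p] := cross_primitive vw'.
have := slope_of_inj vwp w'p; rewrite vb wb => /(_ erefl) w'E.
have := slope_of_inj wp vw'p; rewrite va wa => /(_ erefl) vw'E.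
have {}v'E : v' = v' + w' - w' by rewrite addrK.
have sign (x y : 'cV[int]_2) : cross (y - x) x = cross y x.
  by rewrite /cross !mxE; ring.
rewrite -ve'; move: vw'; rewrite -/(cross _ _) v'E sign {v'E}.
have crossE : cross w (v + w) = -1 by rewrite -vw /cross !mxE; ring.
case: vw'E w'E => -> [] ->; rewrite ?(crossNl, crossNr) crossE // => _.
  by congr slope_of; rewrite opprK addrC.
by rewrite -slope_ofN; congr slope_of; rewrite opprB opprK addrC.
Qed.

Lemma side_vectors_exchange e a b v w : side_vectors (e, a, b) v w ->
  diagonal_exchange e a b (slope_of (v + w + w)).
Proof.
move=> vw; split; first by exists v, w.
case: vw => /= _ wa vb vw; exists (- (v + w + w)), (v + w); split => //=.
- exact: slope_ofN.
- by rewrite -wa -[LHS]slope_ofN opprD opprK addrAC subrr add0r.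
by rewrite -vw !mxE; ring.
Qed.

Lemma side_vectors_rot e a b v w :
  side_vectors (e, a, b) v w -> side_vectors (a, b, e) w (- (v + w)).
Proof.
case=> /= ve wa vb vw; split => //=.
- by rewrite slope_ofN.
- by rewrite -ve -[LHS]slope_ofN opprD opprK addrC addrK.
by rewrite -vw !mxE; ring.
Qed.

Lemma diagonal_exchange_sym e a b e' :
  diagonal_exchange e a b e' -> diagonal_exchange e' b a e.
Proof. by case. Qed.

Lemma diagonal_exchange_inj e a b e1 e2 :
  diagonal_exchange e a b e1 -> diagonal_exchange e a b e2 -> e1 = e2.
Proof.
move=> /diagonal_exchangeP[v [w [[/= ve wa _ vw] ->]]].
move=> /diagonal_exchangeP[v' [w' [[/= v'e w'a _ v'w'] ->]]].
have [vp wp _] := cross_primitive vw; have [v'p w'p _] := cross_primitive v'w'.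
have := slope_of_inj vp v'p; rewrite v'e => /(_ ve).
have := slope_of_inj wp w'p; rewrite w'a => /(_ wa).
move: v'w'; rewrite -/(cross _ _) => v'w' wE vE; move: v'w'.
case: wE vE => -> [] -> //; rewrite ?(crossNl, crossNr) /cross vw // => _.
by rewrite -[LHS]slope_ofN !opprD.
Qed.

(** The parallelogram law for [norm_vector]. *)
Lemma height_exchange e a b e' : diagonal_exchange e a b e' ->
  height e + height e' = 2 * (height a + height b).
Proof.
move=> /diagonal_exchangeP[v [w [[/= <- <- <- vw] ->]]].
have [vp wp vwp] := cross_primitive vw.
have vwwp : primitive_vector (v + w + w).
  by exists w; rewrite -vw /cross !mxE; ring.
by rewrite !height_slope_of // /norm_vector !mxE; ring.
Qed.

Lemma height_neq e a b : ideal_triangulation (e, a, b) ->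
  height e <> height a + height b.
Proof.
move=> [v [w [/= <- <- <- vw]]].
have [vp wp vwp] := cross_primitive vw.
rewrite !height_slope_of // => hE.
(* The discriminant of the form is [-3]. *)
have : 4 * norm_vector v * norm_vector w
    - (norm_vector (v + w) - norm_vector v - norm_vector w) ^+ 2 = 3.
  rewrite -[RHS](_ : 3 * cross v w ^+ 2 = 3); last by rewrite /cross vw.
  by rewrite /norm_vector /cross !mxE; ring.
have -> : norm_vector (v + w) = norm_vector v - norm_vector w by rewrite hE; ring.
have -> : norm_vector v - norm_vector w - norm_vector v - norm_vector w
  = - 2 * norm_vector w by ring.
move: (norm_vector v) (norm_vector w) => x y.
(* A multiple of 4 cannot be equal to 3. *)
have -> : 4 * x * y - (- 2 * y) ^+ 2 = 4 * (x * y - y ^+ 2) by ring.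
by lia.
Qed.

(** * Independence of transports from the sequence of exchanges *)

Section Ascent.

Variables (F : fieldType) (N : nat) (q : F).

Definition agree_on (T : triangulation) (Y Z : slope -> 'M[F]_N) : Prop :=
  forall s, edge_of T s -> Y s = Z s.

Definition rot (T : triangulation) : triangulation := (T.1.2, T.2, T.1.1).

Definition rotation_of (T T' : triangulation) : Prop :=
  [\/ T' = T, T' = rot T | T' = rot (rot T)].

Lemma rotation_of_rot T T' : rotation_of T T' -> rotation_of T (rot T').
Proof.
case: T => -[e a] b [] ->.
- by constructor 2.
- by constructor 3.
by constructor 1.
Qed.

Lemma rotation_of_rotl T T' : rotation_of (rot T) T' -> rotation_of T T'.
Proof.
case: T => -[e a] b [] ->.
- by constructor 2.
- by constructor 3.
by constructor 1.
Qed.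

Lemma rotation_of_sym T T' : rotation_of T T' -> rotation_of T' T.
Proof.
case: T => -[e a] b [] ->.
- by constructor 1.
- by constructor 3.
by constructor 2.
Qed.

Lemma rotation_of_trans T1 T2 T3 :
  rotation_of T1 T2 -> rotation_of T2 T3 -> rotation_of T1 T3.
Proof. by move=> r [] ->; do ?apply: rotation_of_rot. Qed.

Lemma edge_of_rot T s : edge_of (rot T) s <-> edge_of T s.
Proof.
by split=> -[] ->; by [constructor 1 | constructor 2 | constructor 3].
Qed.

Lemma edge_of_rotation T T' s : rotation_of T T' -> edge_of T' s <-> edge_of T s.
Proof. by case=> ->; rewrite ?edge_of_rot. Qed.

Lemma exchange_agree e a b e' (Y Y' Z Z' : slope -> 'M[F]_N) :
    agree_on (e, a, b) Y Y' ->
    CF_exchange q e a b e' Y Z -> CF_exchange q e a b e' Y' Z' ->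
  agree_on (e', b, a) Z Z'.
Proof.
move=> YY' [_ Ze Za Zb] [_ Ze' Za' Zb'].
have [Ee Ea Eb] : [/\ Y e = Y' e, Y a = Y' a & Y b = Y' b].
  by split; apply: YY'; [constructor 1 | constructor 2 | constructor 3].
by move=> s [] /= ->; rewrite ?(Ze, Za, Zb) ?(Ze', Za', Zb') ?(Ee, Ea, Eb).
Qed.

Lemma exchange_agreel e a b e' (Y Y' Z : slope -> 'M[F]_N) :
    agree_on (e, a, b) Y Y' ->
  CF_exchange q e a b e' Y Z -> CF_exchange q e a b e' Y' Z.
Proof.
move=> YY'.
have [Ee Ea Eb] : [/\ Y e = Y' e, Y a = Y' a & Y b = Y' b].
  by split; apply: YY'; [constructor 1 | constructor 2 | constructor 3].
by rewrite /CF_exchange Ee Ea Eb.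
Qed.

(** The second exchange uses the same factors with X_e and X_e^-1 interchanged; polynomials in one
    matrix commute, so everything cancels. *)
Lemma exchangeK e a b e' (X Y Z : slope -> 'M[F]_N) :
    CF_exchange q e a b e' X Y -> CF_exchange q e' b a e Y Z ->
  agree_on (e, a, b) X Z.
Proof.
move=> [[u1 u3 v1 v3] Ye' Ya Yb] [_ Ze Zb Za].
have comm (M : 'M[F]_N) c d : (1%:M + c *: M) *m (1%:M + d *: M)
    = (1%:M + d *: M) *m (1%:M + c *: M).
  rewrite !mulmxDl !mulmxDr !mulmx1 !mul1mx -!scalemxAl -!scalemxAr.
  by rewrite !scalerA (mulrC c) -!addrA; congr (_ + _); rewrite addrCA.
move=> s [] /= ->.
- by rewrite Ze Ye' invmxK.
- rewrite Za Ye' Ya invmxK comm !mulmxA -[invmx _ *m invmx _ *m _]mulmxA.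
  by rewrite mulVmx // mulmx1 mulVmx // mul1mx.
rewrite Zb Ye' Yb comm !mulmxA -[_ *m _ *m invmx (1%:M + q *: _)]mulmxA.
by rewrite mulmxV // mulmx1 mulmxV // mul1mx.
Qed.

Variable X : slope -> 'M[F]_N.

(* Transports from [lambda0] along the reduced paths of the Farey tree. *)
Inductive ascent : triangulation -> (slope -> 'M[F]_N) -> Prop :=
| ascent_refl : ascent lambda0 X
| ascent_rot T Y : ascent T Y -> ascent (rot T) Y
| ascent_exchange e a b e' Y Z :
    ascent (e, a, b) Y -> diagonal_exchange e a b e' ->
    height a + height b < height e' -> CF_exchange q e a b e' Y Z ->
    ascent (e', b, a) Z.

Lemma ascentP T Z : ascent T Z ->
  (rotation_of lambda0 T /\ Z = X) \/
  exists e a b e' Y, [/\ rotation_of (e', b, a) T, ascent (e, a, b) Y,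
    diagonal_exchange e a b e', height a + height b < height e' &
    CF_exchange q e a b e' Y Z].
Proof.
elim=> {T Z} [|T Y _ [[T0 YX]|]|e a b e' Y Z aY _ d h ex].
- by left; split=> //; constructor 1.
- by left; split=> //; exact: rotation_of_rot.
- move=> [e [a [b [e' [Y0 [r aY d h ex]]]]]]; right.
  by exists e, a, b, e', Y0; split=> //; exact: rotation_of_rot.
by right; exists e, a, b, e', Y; split=> //; constructor 1.
Qed.

Lemma height_lambda0 s : edge_of lambda0 s -> height s = 1.
Proof. by case=> /= ->; rewrite /height /norm_vector !mxE. Qed.

Lemma height_ge0 s : 0 <= height s.
Proof. exact: norm_vector_ge0. Qed.

Lemma lambda0_low e a b : rotation_of lambda0 (e, a, b) ->
  height e <= height a + height b.
Proof.
move=> r; have h s : edge_of (e, a, b) s -> height s = 1.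
  by move/(edge_of_rotation _ r)/height_lambda0.
by rewrite !h //; [constructor 3 | constructor 2 | constructor 1].
Qed.

(** Two different edges, each higher than the sum of the two others, would make the height of the
    third negative. *)
Lemma highest_unique e a b e' a' b' : rotation_of (e', a', b') (e, a, b) ->
    height a + height b < height e -> height a' + height b' < height e' ->
  [/\ e' = e, a' = a & b' = b].
Proof.
have h0 := height_ge0; case=> -[-> -> ->] //= h h'.
  by have := h0 b'; lia.
by have := h0 a'; lia.
Qed.

(** The last exchange of an ascent can be read off its end: it created the unique edge higher than
    the sum of the others. Nothing precedes [lambda0], where all heights are 1. *)
Lemma ascent_unique T Y T' Y' : ascent T Y -> ascent T' Y' ->
  rotation_of T T' -> agree_on T Y Y'.
Proof.
move=> aY; elim: aY T' Y' => {T Y}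
  [|T Y _ IH|e a b e' Y Z aY IH d h ex] T' Y' aY'.
- move=> r; case/ascentP: aY' => [[_ ->] //|].
  move=> [e [a [b [e' [Y0 [r' _ _ h _]]]]]].
  have /lambda0_low := rotation_of_trans r (rotation_of_sym r'); lia.
- move=> r s /edge_of_rot sT; exact: (IH _ _ aY' (rotation_of_rotl r)).
move=> r; case/ascentP: aY' => [[r' YX]|].
  have /lambda0_low := rotation_of_trans r' (rotation_of_sym r); lia.
move=> [f [c [d' [f' [Y0 [r' aY0 dd hh ex0]]]]]].
have [] := highest_unique (rotation_of_trans r' (rotation_of_sym r)).
- by rewrite addrC.
- by rewrite addrC.
move=> e1 e2 e3; subst f' c d'.
have ef :=
  diagonal_exchange_inj (diagonal_exchange_sym dd) (diagonal_exchange_sym d).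
subst f; apply: exchange_agree ex ex0; apply: IH aY0 _; by constructor 1.
Qed.

Lemma transport_ascent T Y : CF_transport q lambda0 X T Y ->
  exists2 Y', ascent T Y' & agree_on T Y' Y.
Proof.
elim=> {T Y} [|e a b Y _ [Y' aY' YY']|e a b e' Y Z _ [Y' aY' YY'] d ex].
- by exists X; [exact: ascent_refl |].
- exists Y'; first exact: (ascent_rot aY').
  by move=> s /(edge_of_rot (e, a, b)) /YY'.
have he := height_exchange d; have hn := height_neq d.1.
have ex' : CF_exchange q e a b e' Y' Z.
  by apply: exchange_agreel ex => s sT; rewrite YY'.
(* By [he] and [hn] exactly one of e and e' exceeds the sum of a and b. If it is e', the ascent
   grows; if it is e, then e came from the last ascending exchange, which is now undone. *)
have [lt_e'|ge_e'] := ltP (height a + height b) (height e').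
  by exists Z => //; exact: ascent_exchange aY' d lt_e' ex'.
case/ascentP: (aY') => [[/lambda0_low r _]|]; first by lia.
move=> [f [c [d' [f' [Y0 [r aY0 dd hh ex0]]]]]].
have [] := highest_unique r.
- lia.
- by rewrite addrC.
move=> e1 e2 e3; subst f' c d'.
have ef := diagonal_exchange_inj (diagonal_exchange_sym dd) d.
by subst f; exists Y0 => //; exact: exchangeK ex0 ex'.
Qed.

Lemma transport_unique T Y Y' : CF_transport q lambda0 X T Y ->
  CF_transport q lambda0 X T Y' -> agree_on T Y Y'.
Proof.
move=> /transport_ascent[Z aZ ZY] /transport_ascent[Z' aZ' ZY'] s sT.
rewrite -ZY // -ZY' //; apply: ascent_unique aZ aZ' _ _ sT; by constructor 1.
Qed.

End Ascent.

(** * Transport of standard representations *)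

Section Path.

Variables (F : fieldType) (N : nat) (q : F).
Hypotheses (Nodd : odd N) (qprim : N.-primitive_root q).

Definition conjm (G M : 'M[F]_N) : 'M[F]_N := G *m M *m invmx G.

Lemma conjmM G M M' : G \in unitmx ->
  conjm G M *m conjm G M' = conjm G (M *m M').
Proof. by move=> Gu; rewrite /conjm !mulmxA mulmxKV. Qed.

Lemma conjm_1add G c M : G \in unitmx ->
  1%:M + c *: conjm G M = conjm G (1%:M + c *: M).
Proof.
move=> Gu; rewrite /conjm mulmxDr mulmxDl mulmx1 mulmxV //.
by rewrite -scalemxAr -scalemxAl.
Qed.

Lemma conjm_unit G M : G \in unitmx -> (conjm G M \in unitmx) = (M \in unitmx).
Proof. by move=> Gu; rewrite !unitmx_mul unitmx_inv Gu andbT. Qed.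

Lemma conjmV G M : G \in unitmx -> M \in unitmx ->
  invmx (conjm G M) = conjm G (invmx M).
Proof.
move=> Gu Mu; have Mu' : conjm G M \in unitmx by rewrite conjm_unit.
rewrite -[RHS]mul1mx -(mulVmx Mu') -mulmxA conjmM // mulmxV //.
by rewrite /conjm mulmx1 mulmxV // mulmx1.
Qed.

Lemma conjm_intertwine G C M M' : G \in unitmx -> C \in unitmx ->
  M *m C = C *m M' -> conjm G M = conjm (G *m C) M'.
Proof.
move=> Gu Cu MC; rewrite /conjm -[G *m C *m M']mulmxA -MC.
have GCu : G *m C \in unitmx by rewrite unitmx_mul Gu.
apply: (canRL (mulmxK GCu)); rewrite -!mulmxA (mulmxA (invmx G)).
by rewrite mulVmx // mul1mx.
Qed.

Definition std_at (T : triangulation) (Y : slope -> 'M[F]_N) G u v : Prop :=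
  [/\ Y T.1.1 = conjm G (std1 N q u), Y T.1.2 = conjm G (std2 N v) &
      Y T.2 = conjm G (std3 N q u v)].

Variable X : slope -> 'M[F]_N.

Lemma transport_std_exchange l e a b v w Y G C E A B u' v' (Z := invmx E) :
    CF_transport q l X (e, a, b) Y -> side_vectors (e, a, b) v w ->
    G \in unitmx -> C \in unitmx -> E \in unitmx ->
    Y e = conjm G E -> Y a = conjm G A -> Y b = conjm G B ->
    [/\ 1%:M + q *: E \in unitmx, 1%:M + q ^+ 3 *: E \in unitmx,
        1%:M + q *: Z \in unitmx & 1%:M + q ^+ 3 *: Z \in unitmx] ->
    Z *m C = C *m std3 N q u' v' ->
    (1%:M + q *: E) *m (1%:M + q ^+ 3 *: E) *m A *m C = C *m std2 N v' ->
    invmx (1%:M + q *: Z) *m invmx (1%:M + q ^+ 3 *: Z) *m B *m C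
      = C *m std1 N q u' ->
  exists2 Y', CF_transport q l X (b, a, slope_of (v + w + w)) Y' &
              std_at (b, a, slope_of (v + w + w)) Y' (G *m C) u' v'.
Proof.
move=> tY vw Gu Cu Eu Ye Ya Yb [u1 u3 v1 v3] hE hA hB.
have d := side_vectors_exchange vw; set e' := slope_of (v + w + w) in d *.
have [/= _ wa vwb cvw] := vw.
have e'a : e' != a.
  apply/eqP; rewrite -wa => /slope_of_cross.
  by rewrite (_ : cross _ _ = 1) // -cvw /cross !mxE; ring.
have e'b : e' != b.
  apply/eqP; rewrite -vwb => /slope_of_cross; rewrite crossC => /eqP.
  by rewrite (_ : cross _ _ = 1) // -cvw /cross !mxE; ring.
have ab : a != b.
  apply/eqP; rewrite -wa -vwb => /slope_of_cross; rewrite crossC => /eqP.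
  by rewrite (_ : cross _ _ = 1) // -cvw /cross !mxE; ring.
(* The three slopes are distinct, so cases on the slope are consistent; the default value serves
   b. *)
pose Y' s := if s == e' then conjm (G *m C) (std3 N q u' v')
  else if s == a then conjm (G *m C) (std2 N v')
  else conjm (G *m C) (std1 N q u').
have Y'e : Y' e' = conjm (G *m C) (std3 N q u' v') by rewrite /Y' eqxx.
have Y'a : Y' a = conjm (G *m C) (std2 N v').
  by rewrite /Y' eq_sym (negPf e'a) eqxx.
have Y'b : Y' b = conjm (G *m C) (std1 N q u').
  by rewrite /Y' eq_sym (negPf e'b) eq_sym (negPf ab).
exists Y'; last by [].
(* The exchange lists the edges as e', b, a; one rotation puts b first, where [std1] is expected. *)
apply: (@CF_transport_rotate _ _ _ _ _ e'); apply: CF_transport_exchange tY d _.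
rewrite /CF_exchange Ye Ya Yb Y'e Y'a Y'b conjmV // !conjm_1add //.
rewrite !conjm_unit //; split=> //.
- by rewrite -(conjm_intertwine Gu Cu hE).
- by rewrite !conjmM // -(conjm_intertwine Gu Cu hA).
by rewrite !conjmV // !conjmM // -(conjm_intertwine Gu Cu hB).
Qed.

Definition slopes_of (v w : 'cV[int]_2) : triangulation :=
  (slope_of v, slope_of w, slope_of (v + w)).

Lemma transport_letter l (a : letter) v w Y G u x u' x'
    (C := mxC_letter N q a u x u' x' 1)
    (T := match a with LetterR => slopes_of (v + w) w
                     | LetterL => slopes_of v (v + w) end) :
    cross v w = 1 -> CF_transport q l X (slopes_of v w) Y ->
    G \in unitmx -> std_at (slopes_of v w) Y G u x ->
    u != 0 -> x != 0 -> u' != 0 -> x' != 0 -> weights_step N a u x u' x' ->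
  exists2 Y', CF_transport q l X T Y' & std_at T Y' (G *m C) u' x'.
Proof.
move=> vw tY Gu [Y1 Y2 Y3] u0 x0 u'0 x'0 hw.
have sv : side_vectors (slopes_of v w) v w by split.
have u1 : std1 N q u \in unitmx /\ std2 N x \in unitmx.
  have := std_H Nodd qprim u0 x0; rewrite -mulmxA scalemxAr => H.
  have [? H'] := mulmx1_unit H; split=> //.
  move: H'; rewrite unitmxZ ?unitfE ?expf_neq0 ?(q_neq0 Nodd qprim) //.
  by rewrite unitmx_mul => /andP[].
rewrite /C /T; case: a hw {C T} => hw.
  have [Cu [un hE hA hB]] := letter_intertwiner Nodd qprim u0 x0 u'0 x'0 hw.
  exact: (transport_std_exchange tY sv Gu Cu u1.1 Y1 Y2 Y3 un hE hA hB).
have [Cu [un hE hA hB]] := letter_intertwiner Nodd qprim u0 x0 u'0 x'0 hw.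
have tY' : CF_transport q l X (slope_of w, slope_of (v + w), slope_of v) Y.
  exact: (CF_transport_rotate tY).
have := transport_std_exchange tY' (side_vectors_rot sv) Gu Cu u1.2 Y2 Y3 Y1
  un hE hA hB.
(* Rotation changed the side vectors to w and -(v + w), so the new diagonal appears with the
   opposite sign. *)
have -> : slope_of (w - (v + w) - (v + w)) = slope_of (v + (v + w)).
  by rewrite -slope_ofN; congr slope_of; apply: cV2P; rewrite !mxE; ring.
by [].
Qed.

End Path.

(** * Matrices acting on triangulations *)

Lemma slope_act_sign (sgn : bool) (B : 'M[int]_2) s :
  slope_act ((-1) ^+ sgn *: B) s = slope_act B s.
Proof.
rewrite /slope_act -scalemxAl; case: sgn; rewrite ?expr1 ?expr0 ?scale1r //.
by rewrite scaleN1r slope_ofN.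
Qed.

Lemma sum2 (f : 'I_2 -> int) : \sum_i f i = f 0 + f 1.
Proof. by rewrite big_ord_recl big_ord1; congr (_ + f _); apply: val_inj. Qed.

Lemma triangulation_act_lambda0 (B : 'M[int]_2) :
  triangulation_act B lambda0 = slopes_of (col 0 B) (col 1 B).
Proof.
rewrite /triangulation_act /slopes_of /slope_act /=.
have vec0 : (slope_vector (Some 0) 0 0 = 1) * (slope_vector (Some 0) 1 0 = 0).
  by rewrite !mxE.
have vec1 : (slope_vector (Some 1) 0 0 = 1) * (slope_vector (Some 1) 1 0 = 1).
  by rewrite !mxE.
have vecoo : (slope_vector None 0 0 = 0) * (slope_vector None 1 0 = 1).
  by rewrite !mxE.
by congr (slope_of _, slope_of _, slope_of _); apply/colP => i;
  rewrite [LHS]mxE sum2 ?vec0 ?vec1 ?vecoo !mxE; ring.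
Qed.

(** Multiplying by a letter on the right changes the side vectors exactly as the corresponding
    exchange does in [transport_letter]. *)
Lemma col_letter (B : 'M[int]_2) (a : letter) :
  (col 0 (B *m letter_mx a), col 1 (B *m letter_mx a)) =
  match a with LetterR => (col 0 B + col 1 B, col 1 B)
             | LetterL => (col 0 B, col 0 B + col 1 B) end.
Proof.
by case: a; congr (_, _); apply/colP => i; rewrite !mxE sum2 !mxE /=; ring.
Qed.

Theorem theorem1 (R : realType) (N : nat) (q : R[i])
  (hN : odd N) (hq : N.-primitive_root q)
  (n : nat) (A : nat -> letter) (sgn : bool) (Aphi : 'M[int]_2)
  (hA : Aphi = (-1) ^+ sgn *: \prod_(1 <= i < n.+1) letter_mx (A i))
  (phi : 'rV[R]_2 -> 'rV[R]_2)
  (hphi : lift_of_diffeo Aphi phi) (hpA : pseudo_Anosov_class R Aphi)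
  (p : 'rV[R]_3 -> 'rV[R]_3) (hp : hyperbolic_structure phi p)
  (f : 'rV[R]_3 -> 'rV[R]_3) (hf : pleated_surface p lambda0 f)
  (x : slope -> R[i]) (hx : shear_bend_weights p lambda0 f x)
  (u v : nat -> R[i])
  (huv : forall i, (i <= n)%N -> u i != 0 /\ v i != 0)
  (hu0 : u 0%N ^+ N = x (Some 0)) (hv0 : v 0%N ^+ N = x None)
  (hR : forall i, (1 <= i <= n)%N -> A i = LetterR ->
     u i ^+ N = (u i.-1 ^+ N * v i.-1 ^+ N * (1 + u i.-1 ^- N) ^+ 2)^-1 /\
     v i ^+ N = (1 + u i.-1 ^+ N) ^+ 2 * v i.-1 ^+ N)
  (hL : forall i, (1 <= i <= n)%N -> A i = LetterL ->
     u i ^+ N = u i.-1 ^+ N / (1 + v i.-1 ^- N) ^+ 2 /\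
     v i ^+ N = (1 + v i.-1 ^+ N) ^+ 2 / (u i.-1 ^+ N * v i.-1 ^+ N))
  (hun : u n = u 0%N) (hvn : v n = v 0%N) :
  let Cprod : 'M[R[i]]_N :=
    \big[mulmx/1%:M]_(1 <= i < n.+1)
      mxC_letter N q (A i) (u i.-1) (v i.-1) (u i) (v i) 1 in
  Cprod \in unitmx /\
  forall X : slope -> 'M[R[i]]_N, CF_irrep_with_weights q lambda0 x X ->
    (exists C, quantum_invariant q Aphi lambda0 X C) /\
    (forall C, quantum_invariant q Aphi lambda0 X C -> conj_up_to_scalar C Cprod).
Proof.
move=> Cprod.
pose Ci i := mxC_letter N q (A i) (u i.-1) (v i.-1) (u i) (v i) 1.
pose D k : 'M[R[i]]_N := \big[mulmx/1%:M]_(1 <= i < k.+1) Ci i.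
pose B k : 'M[int]_2 := \prod_(1 <= i < k.+1) letter_mx (A i).
have DS k : D k.+1 = D k *m Ci k.+1.
  exact: (@big_nat_recr _ (1 : 'M[R[i]]_N) *%R k.+1 1 Ci).
have BS k : B k.+1 = B k *m letter_mx (A k.+1) by rewrite /B big_nat_recr.
have step k : (k < n)%N ->
    weights_step N (A k.+1) (u k) (v k) (u k.+1) (v k.+1).
  by move=> kn; case eA: (A k.+1); [apply: hR | apply: hL].
have Du k : (k <= n)%N -> D k \in unitmx.
  elim: k => [|k IHk] kn; first by rewrite /D big_geq // unitmx1.
  have [u0 v0] := huv _ (ltnW kn); have [u1 v1] := huv _ kn.
  rewrite DS unitmx_mul IHk ?(ltnW kn) //.
  by case: (letter_intertwiner hN hq u0 v0 u1 v1 (step _ kn)).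
have Cprodu : Cprod \in unitmx := Du n (leqnn n).
split=> // X [[Xu X12 _ _] _ XN XH].
have [u0 v0] := huv _ (leq0n n).
have edges : [/\ edge_of lambda0 (Some 0), edge_of lambda0 None &
    edge_of lambda0 (Some 1)].
  by split; [constructor 1 | constructor 2 | constructor 3].
have [e1 e2 e3] := edges.
have [Q [Qu XQ1 XQ2]] : exists Q, [/\ Q \in unitmx,
    X (Some 0) *m Q = Q *m std1 N q (u 0) & X None *m Q = Q *m std2 N (v 0)].
  apply: std_model => //.
    by rewrite hu0 -XN // iter_mulmxE.
  by rewrite hv0 -XN // iter_mulmxE.
have conjE M M' : M *m Q = Q *m M' -> M = conjm Q M'.
  by move=> MQ; rewrite /conjm -MQ mulmxK.
have XQ : std_at q lambda0 X Q (u 0) (v 0).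
  split; rewrite /=; apply: conjE => //.
  have stdH := std_H hN hq u0 v0.
  have c3 (a b c : 'M[R[i]]_N) : q ^+ 2 *: (a *m b *m c) = 1%:M ->
      q ^+ 2 *: (c *m a *m b) = 1%:M.
    by rewrite scalemxAl => /mulmx1C; rewrite -scalemxAr mulmxA.
  apply: (third_intertwiner (E := X None) (A := X (Some 0))
    (E' := std2 N (v 0)) (A' := std1 N q (u 0)) _ _ XQ2 XQ1); exact: c3.
(* After k letters, the transported representation is the standard one of parameters u k and v k,
   conjugated by Q D_k. *)
have path k : (k <= n)%N -> cross (col 0 (B k)) (col 1 (B k)) = 1 /\
    exists2 Y,
      CF_transport q lambda0 X (slopes_of (col 0 (B k)) (col 1 (B k))) Y &
      std_at q (slopes_of (col 0 (B k)) (col 1 (B k))) Y (Q *m D k) (u k) (v k).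
  elim: k => [|k IHk] kn.
    rewrite -triangulation_act_lambda0 /B /D !big_geq //.
    have -> : triangulation_act 1 lambda0 = lambda0.
      by rewrite /triangulation_act /slope_act !mul1mx !slope_vectorK.
    split; first by rewrite /cross !mxE.
    by exists X; [exact: CF_transport_refl | rewrite mulmx1].
  have [det1 [Y tY YE]] := IHk (ltnW kn).
  have [u0' v0'] := huv _ (ltnW kn); have [u1 v1] := huv _ kn.
  have QDu : Q *m D k \in unitmx by rewrite unitmx_mul Qu Du // ltnW.
  have := transport_letter hN hq det1 tY QDu YE u0' v0' u1 v1 (step _ kn).
  rewrite -mulmxA -DS BS; have := col_letter (B k) (A k.+1).
  case: (A k.+1) => -[-> ->]; split=> //; rewrite -det1 /cross !mxE; ring.
have [_ [Y tY [Y1 Y2 Y3]]] := path _ (leqnn n).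
have actE :
    triangulation_act Aphi lambda0 = slopes_of (col 0 (B n)) (col 1 (B n)).
  by rewrite -triangulation_act_lambda0 hA /triangulation_act !slope_act_sign.
have [C0 C0def] : exists C0, C0 = conjm Q Cprod by exists (conjm Q Cprod).
have C0u : C0 \in unitmx by rewrite C0def conjm_unit.
(* As the parameters close up at n, the transport is X itself conjugated by Q Cprod Q^-1. *)
have C0E s : edge_of lambda0 s -> Y (slope_act Aphi s) = conjm C0 (X s).
  have conj0 M : conjm (Q *m D n) M = conjm C0 (conjm Q M).
    have C0Q : C0 *m Q = Q *m D n by rewrite C0def /conjm mulmxKV.
    rewrite -C0Q; symmetry; apply: conjm_intertwine => //.
    by rewrite /conjm mulmxKV.
  case: actE => a1 a2 a3; case: XQ => X1 X2 X3.
  move=> [] /= ->; rewrite ?a1 ?a2 ?a3.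
  - by rewrite Y1 X1 hun conj0.
  - by rewrite Y2 X2 hvn conj0.
  by rewrite Y3 X3 hun hvn conj0.
rewrite -actE in tY.
split; first by exists C0; split=> //; exists Y.
move=> C [Cu [X' [tX' X'E]]].
have XE s : edge_of lambda0 s -> conjm C (X s) = conjm C0 (X s).
  move=> sE; rewrite -C0E // [LHS]/conjm -X'E //.
  apply: (transport_unique tX' tY).
  by case: sE => ->; [constructor 1 | constructor 2 | constructor 3].
(* The ratio C0^-1 C of two intertwiners, written in the standard basis, commutes with [std1] and
   [std2] and is therefore scalar. *)
pose M := invmx Q *m invmx C0 *m C *m Q.
have MX s P : edge_of lambda0 s -> X s *m Q = Q *m P -> M *m P = P *m M.
  move=> sE XQs; have := XE _ sE.
  have Cs : C *m X s = conjm C (X s) *m C by rewrite /conjm mulmxKV.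
  have C0s : X s *m invmx C0 = invmx C0 *m conjm C0 (X s).
    by rewrite /conjm !mulmxA mulVmx // mul1mx.
  have Qs : invmx Q *m X s = P *m invmx Q.
    by rewrite -[RHS]mul1mx -(mulVmx Qu) -mulmxA (mulmxA Q) -XQs mulmxK.
  move=> CE; move: Cs C0s; rewrite CE; move: (conjm C0 (X s)) => K Cs C0s.
  rewrite /M -(mulmxA _ Q P) -XQs !mulmxA -(mulmxA _ C) Cs.
  by rewrite !mulmxA -(mulmxA (invmx Q)) -C0s !mulmxA Qs.
have [c Mc] : exists c, M = c%:M.
  by apply: (std_commutant hN hq u0 v0); [exact: MX e1 XQ1 | exact: MX e2 XQ2].
have CE : C = c *: C0.
  have -> : C = C0 *m Q *m M *m invmx Q.
    by rewrite /M !mulmxA !mulmxK // mulmxV // mul1mx.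
  by rewrite Mc mul_mx_scalar -scalemxAl mulmxK.
exists c, Q; split=> //; last by rewrite CE C0def.
apply/eqP => c0; have N0 := odd_gt0 hN.
have /matrixP/(_ (Ordinal N0) (Ordinal N0))/eqP := mulmxV Cu.
by rewrite CE c0 scale0r mul0mx !mxE eq_sym oner_eq0.
Qed.
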